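(* Let $f:\mathbb{R}\to\mathbb{R}$ be smooth, let $F(t)=\int_0^te^{-\int_0^sf(\sigma)\,d\sigma}\,ds$, and assume that $F(-\infty)=a\in\mathbb{R}$ but $F(+\infty)=+\infty$. Consider the equation $$u_{tt}-\Delta u=f(u)(u_t^2-|\nabla u|^2),\quad u(0)=u_0,\quad u_t(0)=u_1$$ with smooth initial data $(u_0,u_1)$ on $\mathbb{R}^3$. If $u_0,\ \nabla u_0,\ u_1\in L^\infty$, then there exists a corresponding smooth solution $u$ on $\mathbb{R}^3\times(-T,T)$, where $$T=\frac{F(\inf u_0)-a}{\big(\|\nabla u_0\|_{L^\infty}+\|u_1\|_{L^\infty}\big)\,\sup F'(u_0)}.$$ Furthermore, $u\in L^\infty_{t,x}(\mathbb{R}^3\times[-t,t])$ for any $t<T$. Similar results hold in the case when $F(+\infty)=b\in\mathbb{R}$.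
   Context: $F$ is strictly increasing; $F(\pm\infty)$ denote its limits at $\pm\infty$. $\sup F'(u_0)$ is the supremum over $x\in\mathbb{R}^3$ of $F'(u_0(x))$. $L^\infty_{t,x}(\mathbb{R}^3\times[-t,t])$ means bounded on $\mathbb{R}^3\times[-t,t]$. *)

(* Defs.v *)
From Stdlib Require Import Reals List.
From Coquelicot Require Import Coquelicot.
Open Scope R_scope.

Notation R3 := (R * R * R)%type.

(* Points of space-time are pairs (x, t). *)
Notation R31 := (R3 * R)%type.

Section Calculus.
Context {E : NormedModule R_AbsRing}.

Definition slice (g : E -> R) (p v : E) : R -> R :=
  fun h => g (plus p (scal h v)).

Definition partial (v : E) (g : E -> R) : E -> R :=
  fun p => Derive (slice g p v) 0.

Fixpoint iter_partial (l : list E) (g : E -> R) : E -> R :=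
  match l with
  | nil => g
  | v :: l' => partial v (iter_partial l' g)
  end.

(* With [basis] the coordinate vectors of E and [D] open: all partial
   derivatives of all orders exist and are continuous on D.  [Derive] is total,
   so existence has to be required separately. *)
Definition smooth_on (basis : list E) (D : E -> Prop) (g : E -> R) : Prop :=
  forall l : list E, incl l basis ->
  forall p : E, D p ->
    continuous (iter_partial l g) p /\
    forall v : E, In v basis -> ex_derive (slice (iter_partial l g) p v) 0.

End Calculus.

Definition bounded_on {E : Type} {V : NormedModule R_AbsRing}
    (D : E -> Prop) (g : E -> V) : Prop :=
  exists M : R, forall p : E, D p -> norm (g p) <= M.

Definition everywhere {E : Type} : E -> Prop := fun _ => True.

(* These are only meaningful for g bounded on the appropriate side; [real]
   sends infinite values to 0. *)
Definition sup_fun {E : Type} (g : E -> R) : R :=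
  real (Lub_Rbar (fun y => exists x : E, y = g x)).
Definition inf_fun {E : Type} (g : E -> R) : R :=
  real (Glb_Rbar (fun y => exists x : E, y = g x)).

(* The essential supremum of |g| is its supremum when g is continuous, and it
   is only used for such g. *)
Definition Linfty_norm {E : Type} {V : NormedModule R_AbsRing} (g : E -> V) : R :=
  sup_fun (fun x => norm (g x)).

(* Coquelicot's norm on a product is the l^2 combination of the norms of the
   factors, hence the Euclidean norm on R3. *)
Lemma norm_R3 (x y z : R) :
  norm ((x, y, z) : R3) = sqrt (x ^ 2 + y ^ 2 + z ^ 2).
Proof.
change (sqrt (sqrt (Rabs x ^ 2 + Rabs y ^ 2) ^ 2 + Rabs z ^ 2)
        = sqrt (x ^ 2 + y ^ 2 + z ^ 2)).
rewrite pow2_sqrt, !pow2_abs; [reflexivity|].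
apply Rplus_le_le_0_compat; apply pow2_ge_0.
Qed.

Definition e1 : R3 := (1, 0, 0).
Definition e2 : R3 := (0, 1, 0).
Definition e3 : R3 := (0, 0, 1).
Definition basis3 : list R3 := e1 :: e2 :: e3 :: nil.

Definition dx1 : R31 := (e1, 0).
Definition dx2 : R31 := (e2, 0).
Definition dx3 : R31 := (e3, 0).
Definition dt : R31 := ((0, 0, 0), 1).
Definition basis31 : list R31 := dx1 :: dx2 :: dx3 :: dt :: nil.

Definition grad (g : R3 -> R) : R3 -> R3 :=
  fun x => (partial e1 g x, partial e2 g x, partial e3 g x).

(* Spatial gradient and Laplacian of a function on space-time. *)
Definition grad_x (u : R31 -> R) : R31 -> R3 :=
  fun p => (partial dx1 u p, partial dx2 u p, partial dx3 u p).
Definition laplacian (u : R31 -> R) : R31 -> R :=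
  fun p => partial dx1 (partial dx1 u) p + partial dx2 (partial dx2 u) p
           + partial dx3 (partial dx3 u) p.

Definition F (f : R -> R) (t : R) : R :=
  RInt (fun s => exp (- RInt f 0 s)) 0 t.

(* R^3 x (-T, T), where T may be +oo. *)
Definition slab (T : Rbar) : R31 -> Prop :=
  fun p => Rbar_lt (Rabs (snd p)) T.

(* R^3 x [-t, t] *)
Definition closed_slab (t : R) : R31 -> Prop :=
  fun p => - t <= snd p <= t.

Definition smooth_solution (f : R -> R) (u0 u1 : R3 -> R) (T : Rbar)
    (u : R31 -> R) : Prop :=
  smooth_on basis31 (slab T) u /\
  (forall p : R31, slab T p ->
     partial dt (partial dt u) p - laplacian u p
     = f (u p) * (partial dt u p ^ 2 - norm (grad_x u p) ^ 2)) /\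
  (forall x : R3, u (x, 0) = u0 x) /\
  (forall x : R3, partial dt u (x, 0) = u1 x).

(* Quotient of a positive number by a nonnegative one, with N / 0 = +oo
   (Coquelicot's [Rbar_div] would give 0). *)
Definition quot (N d : R) : Rbar :=
  if Req_EM_T d 0 then p_infty else Finite (N / d).

Definition lifespan (f : R -> R) (u0 u1 : R3 -> R) (N : R) : Rbar :=
  quot N ((Linfty_norm (grad u0) + Linfty_norm u1)
          * sup_fun (fun x => Derive (F f) (u0 x))).

Definition solvable_up_to (f : R -> R) (u0 u1 : R3 -> R) (T : Rbar) : Prop :=
  exists u : R31 -> R,
    smooth_solution f u0 u1 T u /\
    forall t : R, Rbar_lt t T -> bounded_on (closed_slab t) u.

(* Main.v *)
Require Import Defs.
From Stdlib Require Import Reals List Lra ClassicalEpsilon.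
From Coquelicot Require Import Coquelicot.
Open Scope R_scope.

(** The substitution w = F(u) linearises the equation: since F'' = - f F', it
    turns u_tt - Delta u = f(u) (u_t^2 - |grad u|^2) into w_tt = Delta w, with
    data w0 = F(u0) and w1 = F'(u0) u1.  The linear problem in dimension three
    is solved by Kirchhoff's formula, in which w(x, t) is the average over unit
    vectors om of
      w0(x + t om) + t (om . grad w0(x + t om) + w1(x + t om)).
    Hence w stays within |t| d of the range of w0, where
    d = (sup |grad u0| + sup |u1|) sup F'(u0) bounds the factor of t
    ([kirchhoff_bounds], [speed_bound]).  As long as |t| d is smaller than the
    distance from F(inf u0) and F(sup u0) to the finite ends of the range of F,
    the values of w at times up to |t| lie between two values of F, so
    u = F^{-1}(w) exists and is bounded there ([solvable_of_wave]); |t| d is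
    that small exactly up to the stated lifespan.

    That Kirchhoff's formula solves the wave equation rests on one identity
    ([sphere_mean_laplacian]): if M g(x, t) is the average of g(x + t om), then
    t M(Delta g) = d^2/dt^2 (t M g).  In spherical coordinates the difference of
    the two integrands, multiplied by the area density sin th, is the divergence
    of a field that is smooth up to the poles, so the identity follows by
    integrating in each angle, for t of either sign.  The solution with data (w0, w1) is
    then d/dt (t M w0) + t M w1.

    Smoothness is propagated through recursively defined classes C^n, for which
    closure under the operations used is an induction on n.  A spherical mean is
    differentiated under the integral sign.  For u itself, the implicit equation
    F(u) = w gives continuity and then d_v u = d_v w exp(int_0^u f), whose right
    hand side is of class C^n as soon as u is. *)

(** * The classes C^n *)

Lemma is_derive_shift (g : R -> R) (c h l : R) :
  is_derive (fun k => g (c + k)) h l <-> is_derive g (c + h) l.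
Proof.
  split; intros H.
  - apply (is_derive_ext (fun x => g (c + (x - c)))).
    { intros x. now rewrite Rplus_minus. }
    rewrite <- (scal_one l).
    apply (is_derive_comp (fun k => g (c + k)) (fun x => x - c) (c + h) l 1).
    + now replace (c + h - c) with h by ring.
    + auto_derive; auto; ring.
  - rewrite <- (scal_one l). apply (is_derive_comp g (fun k => c + k) h l 1); auto.
    auto_derive; auto; ring.
Qed.

Section ClassC.
Context {E : NormedModule R_AbsRing}.

Definition has_partial (v : E) (g : E -> R) (p : E) (l : R) : Prop :=
  is_derive (slice g p v) 0 l.

(** The witnesses [gv] are existential, rather than [partial v g], so that
    every closure property can supply its own formula for the derivative. *)
Fixpoint class_C (n : nat) (basis : list E) (D : E -> Prop) (g : E -> R) : Prop :=
  (forall p, D p -> continuous g p) /\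
  match n with
  | O => True
  | S n' => forall v, In v basis ->
      exists gv, (forall p, D p -> has_partial v g p (gv p)) /\ class_C n' basis D gv
  end.

Lemma scal_R0 (v : E) : scal 0 v = zero.
Proof. exact (scal_zero_l v). Qed.

Lemma scal_Rplus (h k : R) (v : E) : scal (h + k) v = plus (scal h v) (scal k v).
Proof. exact (scal_distr_r h k v). Qed.

Lemma slice_0 (g : E -> R) (p v : E) : slice g p v 0 = g p.
Proof.
  unfold slice. rewrite scal_R0. now rewrite plus_zero_r.
Qed.

Lemma slice_shift (g : E -> R) (p v : E) (h k : R) :
  slice g (plus p (scal h v)) v k = slice g p v (h + k).
Proof.
  unfold slice. now rewrite scal_Rplus, plus_assoc.
Qed.

Lemma continuous_slice_arg (p v : E) (h : R) :
  continuous (fun h : R => plus p (scal h v)) h.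
Proof.
  apply (continuous_plus (fun _ : R => p) (fun h : R => scal h v)).
  - apply continuous_const.
  - apply (continuous_scal_l (fun h : R => h) v). apply continuous_id.
Qed.

Lemma continuous_slice (g : E -> R) (p v : E) :
  continuous g p -> continuous (slice g p v) 0.
Proof.
  intros H. apply (continuous_comp (fun h : R => plus p (scal h v)) g).
  - apply continuous_slice_arg.
  - now rewrite scal_R0, plus_zero_r.
Qed.

(** A partial derivative at a point of a line is the derivative along that
    line; this turns the pointwise notion, which only sees the parameter 0,
    into differentiability of the restriction to lines. *)
Lemma has_partial_along (v : E) (g : E -> R) (p : E) (h l : R) :
  has_partial v g (plus p (scal h v)) l -> is_derive (slice g p v) h l.
Proof.
  intros H. replace h with (h + 0) by ring.
  apply (proj1 (is_derive_shift (slice g p v) h 0 l)).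
  revert H. apply is_derive_ext. intros k. apply slice_shift.
Qed.

Lemma partial_eq (v : E) (g : E -> R) (p : E) (l : R) :
  has_partial v g p l -> partial v g p = l.
Proof. apply is_derive_unique. Qed.

Lemma has_partial_locally (v : E) (g g' : E -> R) (p : E) (l : R) :
  locally p (fun q => g q = g' q) -> has_partial v g p l -> has_partial v g' p l.
Proof.
  intros H. unfold has_partial. apply is_derive_ext_loc.
  pose proof (continuous_slice_arg p v 0) as Hc.
  apply (Hc (fun q => g q = g' q)).
  rewrite scal_R0, plus_zero_r. exact H.
Qed.

Lemma class_C_continuous n basis D g (p : E) :
  class_C n basis D g -> D p -> continuous g p.
Proof. destruct n; intros [H _]; apply H. Qed.

Lemma class_C_ext n basis D (HD : open D) : forall g g' : E -> R,
  (forall p, D p -> g p = g' p) -> class_C n basis D g -> class_C n basis D g'.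
Proof.
  destruct n as [|n]; intros g g' Heq [Hc Hd]; split; auto.
  1,2: intros p Hp; apply continuous_ext_loc with g; auto;
    generalize (HD p Hp); apply filter_imp; intros q Hq; now rewrite Heq.
  intros v Hv. destruct (Hd v Hv) as [gv [H1 H2]]. exists gv. split; auto.
  intros p Hp. apply has_partial_locally with g; auto.
  generalize (HD p Hp); apply filter_imp; auto.
Qed.

Lemma class_C_weaken n basis D : forall g : E -> R,
  class_C (S n) basis D g -> class_C n basis D g.
Proof.
  induction n as [|n IH]; intros g [Hc Hd]; split; auto.
  intros v Hv. destruct (Hd v Hv) as [gv [H1 H2]]. exists gv; auto.
Qed.

Lemma class_C_subset n basis (D D' : E -> Prop) : (forall p, D' p -> D p) ->
  forall g : E -> R, class_C n basis D g -> class_C n basis D' g.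
Proof.
  intros HD. induction n as [|n IH]; intros g [Hc Hd]; split; auto.
  intros v Hv. destruct (Hd v Hv) as [gv [H1 H2]]. exists gv; auto.
Qed.

Lemma class_C_partial n basis D (HD : open D) (g : E -> R) v :
  class_C (S n) basis D g -> In v basis -> class_C n basis D (partial v g).
Proof.
  intros [_ Hd] Hv. destruct (Hd v Hv) as [gv [H1 H2]].
  apply (class_C_ext n basis D HD gv); auto.
  intros p Hp. symmetry. now apply partial_eq, H1.
Qed.

Lemma class_C_has_partial n basis D (g : E -> R) v p :
  class_C (S n) basis D g -> In v basis -> D p -> has_partial v g p (partial v g p).
Proof.
  intros [_ Hd] Hv Hp. destruct (Hd v Hv) as [gv [H1 H2]].
  unfold has_partial, partial. apply Derive_correct. exists (gv p). now apply H1.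
Qed.

Lemma smooth_on_class_C basis D (g : E -> R) :
  smooth_on basis D g -> forall n, class_C n basis D g.
Proof.
  intros H n.
  enough (Hl : forall l, incl l basis -> class_C n basis D (iter_partial l g)).
  { apply (Hl nil). intros v []. }
  induction n as [|n IH]; intros l Hl; split; auto.
  1,2: intros p Hp; now apply (H l Hl p Hp).
  intros v Hv. exists (iter_partial (v :: l) g). split.
  - intros p Hp. apply Derive_correct. now apply (H l Hl p Hp).
  - apply IH. intros w [<-|Hw]; auto.
Qed.

Lemma class_C_smooth_on basis D (HD : open D) (g : E -> R) :
  (forall n, class_C n basis D g) -> smooth_on basis D g.
Proof.
  intros H l Hl.
  assert (Hit : forall n, class_C n basis D (iter_partial l g)).
  { induction l as [|v l IH]; simpl; auto.
    intros n. apply class_C_partial; auto.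
    - apply IH. intros w Hw. apply Hl. now right.
    - apply Hl. now left. }
  intros p Hp. split.
  - now apply (class_C_continuous 0 basis D).
  - intros v Hv. exists (partial v (iter_partial l g) p).
    now apply (class_C_has_partial 0 basis D).
Qed.

Lemma class_C_const n basis D (c : R) : class_C n basis D (fun _ : E => c).
Proof.
  revert c. induction n as [|n IH]; intros c; split; auto.
  1,2: intros; apply continuous_const.
  intros v _. exists (fun _ => 0). split; auto.
  intros p _. apply (is_derive_const c 0).
Qed.

Lemma class_C_plus n basis D : forall g h : E -> R,
  class_C n basis D g -> class_C n basis D h ->
  class_C n basis D (fun p => g p + h p).
Proof.
  induction n as [|n IH]; intros g h [Hg1 Hg2] [Hh1 Hh2]; split; auto.
  1,2: intros p Hp; now apply (continuous_plus g h); auto.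
  intros v Hv. destruct (Hg2 v Hv) as [gv [G1 G2]], (Hh2 v Hv) as [hv [H1 H2]].
  exists (fun p => gv p + hv p). split; auto.
  intros p Hp. apply (is_derive_plus (slice g p v) (slice h p v) 0); auto.
  now apply G1. now apply H1.
Qed.

Lemma class_C_mult n basis D : forall g h : E -> R,
  class_C n basis D g -> class_C n basis D h ->
  class_C n basis D (fun p => g p * h p).
Proof.
  induction n as [|n IH]; intros g h Hg Hh;
    pose proof Hg as [Hg1 Hg2]; pose proof Hh as [Hh1 Hh2]; split; auto.
  1,2: intros p Hp; now apply (continuous_mult g h); auto.
  intros v Hv. destruct (Hg2 v Hv) as [gv [G1 G2]], (Hh2 v Hv) as [hv [H1 H2]].
  exists (fun p => gv p * h p + g p * hv p). split.
  - intros p Hp. specialize (G1 p Hp). specialize (H1 p Hp).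
    unfold has_partial in *.
    pose proof (is_derive_mult (slice g p v) (slice h p v) 0 _ _ G1 H1) as HH.
    rewrite !slice_0 in HH. apply HH. intros; apply Rmult_comm.
  - apply class_C_plus; apply IH; auto; now apply class_C_weaken.
Qed.

End ClassC.

(** * Functions of one variable *)

Definition class_C1 (n : nat) : (R -> R) -> Prop :=
  class_C (E := R_NormedModule) n (1 :: nil) everywhere.

Lemma has_partial_R (g : R -> R) (x l : R) :
  has_partial (E := R_NormedModule) 1 g x l <-> is_derive g x l.
Proof.
  rewrite <- (Rplus_0_r x) at 2. rewrite <- is_derive_shift.
  assert (Hs : forall h, g (x + h) = slice (E := R_NormedModule) g x 1 h).
  { intros h. unfold slice. f_equal. change (x + h = x + h * 1). ring. }
  split; apply is_derive_ext; intros h; rewrite Hs; reflexivity.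
Qed.

Lemma class_C1_S n (phi dphi : R -> R) :
  (forall x, is_derive phi x (dphi x)) -> class_C1 n dphi -> class_C1 (S n) phi.
Proof.
  intros H1 H2. split.
  - intros x _. apply (ex_derive_continuous phi x). now exists (dphi x).
  - intros v [<-|[]]. exists dphi. split; auto. intros x _. now apply has_partial_R.
Qed.

Lemma class_C1_inv n (phi : R -> R) : class_C1 (S n) phi ->
  exists dphi, (forall x, is_derive phi x (dphi x)) /\ class_C1 n dphi.
Proof.
  intros [_ H]. destruct (H 1) as [d [H1 H2]]. now left.
  exists d. split; auto. intros x. apply has_partial_R. now apply H1.
Qed.

Lemma class_C1_of_ex_derive_n (f : R -> R) :
  (forall n x, ex_derive_n f n x) -> forall n, class_C1 n f.
Proof.
  intros H n.
  enough (Hk : forall k, class_C1 n (Derive_n f k)) by apply (Hk 0%nat).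
  induction n as [|n IH]; intros k.
  - split; auto. intros x _. apply (ex_derive_continuous (Derive_n f k) x). apply (H (S k) x).
  - apply (class_C1_S n _ (Derive_n f (S k))); auto.
    intros x. apply Derive_correct. apply (H (S k) x).
Qed.

Section Composition.
Context {E : NormedModule R_AbsRing}.

Lemma has_partial_comp (v : E) (g : E -> R) (phi : R -> R) (p : E) (l d : R) :
  is_derive phi (g p) d -> has_partial v g p l ->
  has_partial v (fun q => phi (g q)) p (l * d).
Proof.
  intros H1 H2. apply (is_derive_comp phi (slice g p v) 0 d l); auto.
  now rewrite slice_0.
Qed.

(** Only the one-variable chain rule is involved, because a partial derivative
    sees its argument along a line. *)
Lemma class_C_comp n basis D : forall (phi : R -> R) (g : E -> R),
  class_C1 n phi -> class_C n basis D g ->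
  class_C n basis D (fun p => phi (g p)).
Proof.
  induction n as [|n IH]; intros phi g Hphi Hg;
    pose proof Hphi as [P1 _]; pose proof Hg as [G1 G2]; split; auto.
  1,2: intros p Hp; apply (continuous_comp g phi); auto; apply P1; exact I.
  destruct (class_C1_inv n phi Hphi) as [d [D1 D2]].
  intros v Hv. destruct (G2 v Hv) as [gv [G3 G4]].
  exists (fun p => gv p * d (g p)). split.
  - intros p Hp. apply has_partial_comp; auto.
  - apply class_C_mult; auto. apply IH; auto. now apply class_C_weaken.
Qed.
End Composition.

(** * Continuity everywhere *)

Definition cont {U V : UniformSpace} (f : U -> V) : Prop := forall x, continuous f x.

Section Cont.
Context {U V W : UniformSpace}.
Lemma cont_const (c : V) : cont (fun _ : U => c).
Proof. intros x. apply continuous_const. Qed.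
Lemma cont_id : cont (fun x : U => x).
Proof. intros x. apply continuous_id. Qed.
Lemma cont_comp (f : U -> V) (g : V -> W) : cont f -> cont g -> cont (fun x => g (f x)).
Proof. intros Hf Hg x. now apply (continuous_comp f g). Qed.
Lemma cont_pair (f : U -> V) (g : U -> W) : cont f -> cont g -> cont (fun x => (f x, g x)).
Proof.
  intros Hf Hg x. apply (continuous_comp_2 f g (fun a b => (a, b))); auto.
  apply continuous_ext with (fun q : V * W => q). now intros []. apply continuous_id.
Qed.
Lemma cont_fst : cont (fst : V * W -> V).
Proof. intros [a b]. apply continuous_fst. Qed.
Lemma cont_snd : cont (snd : V * W -> W).
Proof. intros [a b]. apply continuous_snd. Qed.
End Cont.

Lemma cont_comp2 {U V W X : UniformSpace} (f : U -> V) (g : U -> W) (h : V -> W -> X) :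
  cont f -> cont g -> cont (fun q : V * W => h (fst q) (snd q)) ->
  cont (fun x => h (f x) (g x)).
Proof. intros Hf Hg Hh x. now apply continuous_comp_2. Qed.

Lemma cont_plus {U : UniformSpace} (f g : U -> R) :
  cont f -> cont g -> cont (fun x => f x + g x).
Proof. intros Hf Hg x. now apply (continuous_plus f g). Qed.
Lemma cont_mult {U : UniformSpace} (f g : U -> R) :
  cont f -> cont g -> cont (fun x => f x * g x).
Proof. intros Hf Hg x. now apply (continuous_mult f g). Qed.
Lemma cont_opp {U : UniformSpace} (f : U -> R) :
  cont f -> cont (fun x => - f x).
Proof. intros Hf x. now apply (continuous_opp f). Qed.
Lemma cont_minus {U : UniformSpace} (f g : U -> R) :
  cont f -> cont g -> cont (fun x => f x - g x).
Proof. intros Hf Hg x. now apply (continuous_minus f g). Qed.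
Lemma cont_sin {U : UniformSpace} (f : U -> R) : cont f -> cont (fun x => sin (f x)).
Proof. intros Hf. apply (cont_comp f sin); auto. intros x; apply continuous_sin. Qed.
Lemma cont_cos {U : UniformSpace} (f : U -> R) : cont f -> cont (fun x => cos (f x)).
Proof. intros Hf. apply (cont_comp f cos); auto. intros x; apply continuous_cos. Qed.
Lemma cont_fst' {U V W : UniformSpace} (f : U -> V * W) : cont f -> cont (fun x => fst (f x)).
Proof. intros Hf. apply (cont_comp f fst); auto. apply cont_fst. Qed.
Lemma cont_snd' {U V W : UniformSpace} (f : U -> V * W) : cont f -> cont (fun x => snd (f x)).
Proof. intros Hf. apply (cont_comp f snd); auto. apply cont_snd. Qed.

Ltac cont_tac :=
  lazymatch goal with
  | |- cont (fun x => x) => apply cont_id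
  | |- cont (fun _ => ?c) => apply cont_const
  | |- cont (fun x => @?f x + @?g x) => apply (cont_plus f g); cont_tac
  | |- cont (fun x => @?f x * @?g x) => apply (cont_mult f g); cont_tac
  | |- cont (fun x => @?f x - @?g x) => apply (cont_minus f g); cont_tac
  | |- cont (fun x => - @?f x) => apply (cont_opp f); cont_tac
  | |- cont (fun x => sin (@?f x)) => apply (cont_sin f); cont_tac
  | |- cont (fun x => cos (@?f x)) => apply (cont_cos f); cont_tac
  | |- cont (fun x => fst (@?f x)) => apply (cont_fst' f); cont_tac
  | |- cont (fun x => snd (@?f x)) => apply (cont_snd' f); cont_tac
  | |- cont (fun x => (@?f x, @?g x)) => apply (cont_pair f g); cont_tac
  | H : cont ?g |- cont ?g => exact H
  | H : cont (fun q => ?h (fst q) (snd q)) |- cont (fun x => ?h (@?f x) (@?g x)) =>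
      apply (cont_comp2 f g h); [ cont_tac | cont_tac | exact H ]
  | H : cont ?g |- cont (fun x => ?g (@?f x)) =>
      apply (cont_comp f g); [ cont_tac | exact H ]
  | |- _ => idtac
  end.

(** * Integrals depending on a parameter *)

Lemma ex_RInt_cont (f : R -> R) (a b : R) : cont f -> ex_RInt f a b.
Proof. intros H. apply (ex_RInt_continuous f). auto. Qed.

Lemma cont_section {E F : UniformSpace} (k : E -> F -> R) (p : E) :
  cont (fun q : E * F => k (fst q) (snd q)) -> cont (k p).
Proof.
  intros H. apply (cont_comp2 (fun _ => p) (fun s => s) k); cont_tac.
Qed.

(** Continuity in the parameter is uniform on the compact segment; this is
    what lets it pass through the integral. *)
Lemma continuous_uniformly_on_segment {E : UniformSpace} (k : E -> R -> R) (a b : R) (p : E)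
    (eps : posreal) :
  cont (fun q : E * R => k (fst q) (snd q)) ->
  locally p (fun p' => forall s, a <= s <= b -> Rabs (k p' s - k p s) < eps).
Proof.
  intros Hk.
  assert (Hd : forall s, exists d : posreal, forall p' s', ball p d p' -> ball s d s' ->
            Rabs (k p' s' - k p s) < eps / 2).
  { intros s. destruct (Hk (p, s) (fun y => Rabs (y - k p s) < eps / 2)) as [d Hd].
    - exists (pos_div_2 eps). intros y Hy. exact Hy.
    - exists d. intros p' s' H1 H2. apply (Hd (p', s')). now split. }
  set (delta := fun s => proj1_sig (constructive_indefinite_description _ (Hd s))).
  assert (Hdelta : forall s p' s', ball p (delta s) p' -> ball s (delta s) s' ->
            Rabs (k p' s' - k p s) < eps / 2).
  { intros s. apply (proj2_sig (constructive_indefinite_description _ (Hd s))). }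
  destruct (compactness_value_1d a b delta) as [d Hd'].
  exists d. intros p' Hp' s Hs. apply Rnot_le_lt. intros Hle.
  apply (Hd' s Hs). intros [t [_ [Hst Hdt]]].
  assert (Hb : ball t (delta t) s) by exact Hst.
  pose proof (Hdelta t p' s (ball_le _ _ _ Hdt _ Hp') Hb) as B1.
  pose proof (Hdelta t p s (ball_center p (delta t)) Hb) as B2.
  pose proof (Rabs_triang (k p' s - k p t) (- (k p s - k p t))) as B3.
  rewrite Rabs_Ropp in B3.
  replace (k p' s - k p t + - (k p s - k p t)) with (k p' s - k p s) in B3 by ring. lra.
Qed.

Lemma cont_RInt_param {E : UniformSpace} (k : E -> R -> R) (a b : R) : a <= b ->
  cont (fun q : E * R => k (fst q) (snd q)) -> cont (fun p => RInt (k p) a b).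
Proof.
  intros Hab Hk p. apply filterlim_locally. intros eps.
  assert (Heps : 0 < eps / (b - a + 1)) by (apply Rdiv_lt_0_compat; [apply eps|lra]).
  generalize (continuous_uniformly_on_segment k a b p (mkposreal _ Heps) Hk).
  apply filter_imp. intros p' Hp'.
  change (Rabs (RInt (k p') a b - RInt (k p) a b) < eps).
  assert (Hex : forall q, ex_RInt (k q) a b) by (intros q; apply ex_RInt_cont, cont_section, Hk).
  rewrite <- (RInt_minus (k p') (k p)) by apply Hex.
  apply Rle_lt_trans with ((b - a) * (eps / (b - a + 1))).
  - apply abs_RInt_le_const; auto.
    + apply (ex_RInt_minus (k p') (k p)); apply Hex.
    + intros t Ht. apply Rlt_le. now apply (Hp' t Ht).
  - apply Rmult_lt_reg_r with (b - a + 1); [lra|].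
    replace ((b - a) * (eps / (b - a + 1)) * (b - a + 1)) with ((b - a) * eps) by (field; lra).
    pose proof (cond_pos eps). nra.
Qed.

Lemma is_derive_RInt_cont (k dk : R -> R -> R) (a b h : R) :
  (forall h s, is_derive (fun h => k h s) h (dk h s)) ->
  cont (fun q : R * R => k (fst q) (snd q)) ->
  cont (fun q : R * R => dk (fst q) (snd q)) ->
  is_derive (fun h => RInt (k h) a b) h (RInt (dk h) a b).
Proof.
  intros Hd Hk Hdk.
  replace (RInt (dk h) a b) with (RInt (fun s => Derive (fun u => k u s) h) a b).
  - apply (is_derive_RInt_param k a b h).
    + apply filter_forall. intros x t _. exists (dk x t). apply Hd.
    + intros t _. apply continuity_2d_pt_ext with dk.
      * intros x y. symmetry. apply is_derive_unique, Hd.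
      * apply continuity_2d_pt_filterlim. apply (Hdk (h, t)).
    + apply filter_forall. intros x. apply ex_RInt_cont, (cont_section k), Hk.
  - apply RInt_ext. intros s _. apply is_derive_unique, Hd.
Qed.

(** * The chain rule along curves *)

(** A two-variable chain rule along the diagonal; nested uses of it give the
    chain rule along a curve in space. *)
Lemma is_derive_diagonal (K K1 : R -> R -> R) (s d2 : R) :
  (forall x y, is_derive (fun z => K z y) x (K1 x y)) ->
  is_derive (fun z => K s z) s d2 ->
  continuous (fun u : R * R => K1 (fst u) (snd u)) (s, s) ->
  is_derive (fun z => K z z) s (K1 s s + d2).
Proof.
  intros H1 H2 Hc.
  pose proof (is_derive_filterdiff K s s K1 d2
    (filter_forall (fun u : R * R => is_derive (fun z => K z (snd u)) (fst u) (K1 (fst u) (snd u)))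
      (fun u => H1 (fst u) (snd u))) H2 Hc) as HK.
  unfold is_derive.
  apply filterdiff_ext_lin with (fun y : R => plus (scal y (K1 s s)) (scal y d2)).
  - apply (filterdiff_comp'_2 (fun z : R => z) (fun z : R => z) K s (fun z : R => z)
      (fun z : R => z) (fun a b => plus (scal a (K1 s s)) (scal b d2))).
    + apply filterdiff_id.
    + apply filterdiff_id.
    + apply HK.
  - intros y. change (y * K1 s s + y * d2 = y * (K1 s s + d2)). ring.
Qed.

Lemma is_derive_coord (g : R3 -> R) (x y z l : R) :
  (has_partial e1 g (x, y, z) l -> is_derive (fun a => g (a, y, z)) x l) /\
  (has_partial e2 g (x, y, z) l -> is_derive (fun a => g (x, a, z)) y l) /\
  (has_partial e3 g (x, y, z) l -> is_derive (fun a => g (x, y, a)) z l).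
Proof.
  assert (Haux : forall (k : R -> R) c, is_derive (fun h => k (c + h)) 0 l -> is_derive k c l).
  { intros k c H. rewrite <- (Rplus_0_r c). exact (proj1 (is_derive_shift k c 0 l) H). }
  split; [|split]; intros H; apply Haux; revert H; apply is_derive_ext; intros t;
    unfold slice; f_equal;
    match goal with |- ?a = ?b => change a with (x + t * 1, y + t * 0, z + t * 0) || 
       change a with (x + t * 0, y + t * 1, z + t * 0) || change a with (x + t * 0, y + t * 0, z + t * 1) end;
    rewrite ?Rmult_0_r, ?Rplus_0_r, ?Rmult_1_r; reflexivity.
Qed.

Lemma is_derive_along_curve (g g1 g2 g3 : R3 -> R) (c1 c2 c3 d1 d2 d3 : R -> R) (s : R) :
  (forall p, has_partial e1 g p (g1 p)) ->
  (forall p, has_partial e2 g p (g2 p)) ->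
  (forall p, has_partial e3 g p (g3 p)) ->
  cont g1 -> cont g2 ->
  (forall s, is_derive c1 s (d1 s)) -> (forall s, is_derive c2 s (d2 s)) ->
  (forall s, is_derive c3 s (d3 s)) ->
  cont d1 -> cont d2 ->
  is_derive (fun s => g (c1 s, c2 s, c3 s)) s
    (d1 s * g1 (c1 s, c2 s, c3 s) + (d2 s * g2 (c1 s, c2 s, c3 s)
      + d3 s * g3 (c1 s, c2 s, c3 s))).
Proof.
  intros P1 P2 P3 C1 C2 H1 H2 H3 D1 D2.
  assert (Hcd : forall c d : R -> R, (forall s, is_derive c s (d s)) -> cont c).
  { intros c d H x. apply (ex_derive_continuous c x). now exists (d x). }
  pose proof (Hcd _ _ H1) as K1. pose proof (Hcd _ _ H2) as K2. pose proof (Hcd _ _ H3) as K3.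
  apply (is_derive_diagonal (fun a b => g (c1 a, c2 b, c3 b))
    (fun a b => d1 a * g1 (c1 a, c2 b, c3 b))).
  - intros x y. apply (is_derive_comp (fun a => g (a, c2 y, c3 y)) c1); auto.
    exact (proj1 (is_derive_coord g _ _ _ _) (P1 _)).
  - apply (is_derive_diagonal (fun a b => g (c1 s, c2 a, c3 b))
      (fun a b => d2 a * g2 (c1 s, c2 a, c3 b))).
    + intros x y. apply (is_derive_comp (fun a => g (c1 s, a, c3 y)) c2); auto.
      exact (proj1 (proj2 (is_derive_coord g _ _ _ _)) (P2 _)).
    + apply (is_derive_comp (fun a => g (c1 s, c2 s, a)) c3); auto.
      exact (proj2 (proj2 (is_derive_coord g _ _ _ _)) (P3 _)).
    + refine ((fun HC : cont (fun u : R * R => d2 (fst u) * g2 (c1 s, c2 (fst u), c3 (snd u))) => HC (s, s)) _).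
      cont_tac.
  - refine ((fun HC : cont (fun u : R * R => d1 (fst u) * g1 (c1 (fst u), c2 (snd u), c3 (snd u))) => HC (s, s)) _).
    cont_tac.
Qed.

(** * Averages over the unit sphere *)

Definition sphere_point (th ph : R) : R3 := (sin th * cos ph, sin th * sin ph, cos th).

(** The area element of the unit sphere is sin th dth dph and its total area
    is 4 PI. *)
Definition sphere_mean (k : R3 -> R) : R :=
  RInt (fun th => RInt (fun ph => sin th * / (4 * PI) * k (sphere_point th ph)) 0 (2 * PI)) 0 PI.

Lemma two_PI_ge_0 : 0 <= 2 * PI.
Proof. pose proof PI_RGT_0; lra. Qed.
Lemma PI_ge_0 : 0 <= PI.
Proof. pose proof PI_RGT_0; lra. Qed.

Lemma cont_sphere_integrand {E : UniformSpace} (k : E -> R3 -> R) :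
  cont (fun q : E * R3 => k (fst q) (snd q)) ->
  cont (fun q : (E * R) * R => sin (snd (fst q)) * / (4 * PI)
          * k (fst (fst q)) (sphere_point (snd (fst q)) (snd q))).
Proof. intros Hk. unfold sphere_point. cont_tac. Qed.

Lemma cont_sphere_inner {E : UniformSpace} (k : E -> R3 -> R) :
  cont (fun q : E * R3 => k (fst q) (snd q)) ->
  cont (fun q : E * R => RInt (fun ph => sin (snd q) * / (4 * PI)
          * k (fst q) (sphere_point (snd q) ph)) 0 (2 * PI)).
Proof.
  intros Hk.
  apply (cont_RInt_param (E := prod_UniformSpace E R_UniformSpace)
    (fun (q : E * R) ph => sin (snd q) * / (4 * PI) * k (fst q) (sphere_point (snd q) ph))).
  - apply two_PI_ge_0.
  - now apply cont_sphere_integrand.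
Qed.

Lemma cont_sphere_mean {E : UniformSpace} (k : E -> R3 -> R) :
  cont (fun q : E * R3 => k (fst q) (snd q)) -> cont (fun p => sphere_mean (k p)).
Proof.
  intros Hk. apply (cont_RInt_param (fun (p : E) th => RInt (fun ph => sin th * / (4 * PI)
          * k p (sphere_point th ph)) 0 (2 * PI))).
  - apply PI_ge_0.
  - now apply cont_sphere_inner.
Qed.

Section Mean.
Variables (k l : R3 -> R).
Hypotheses (Hk : cont k) (Hl : cont l).

Lemma ex_RInt_sphere_inner th :
  ex_RInt (fun ph => sin th * / (4 * PI) * k (sphere_point th ph)) 0 (2 * PI).
Proof. apply ex_RInt_cont. unfold sphere_point. cont_tac. Qed.

Lemma ex_RInt_sphere_outer :
  ex_RInt (fun th => RInt (fun ph => sin th * / (4 * PI) * k (sphere_point th ph)) 0 (2 * PI)) 0 PI.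
Proof.
  apply ex_RInt_cont.
  apply (cont_section (E := R_UniformSpace) (fun (_ : R) th => RInt (fun ph => sin th * / (4 * PI)
    * k (sphere_point th ph)) 0 (2 * PI)) 0).
  apply (cont_sphere_inner (fun (_ : R) => k)). cont_tac.
Qed.
End Mean.

Lemma sphere_mean_ext (k l : R3 -> R) :
  (forall om, k om = l om) -> sphere_mean k = sphere_mean l.
Proof.
  intros H. apply RInt_ext. intros th _. apply RInt_ext. intros ph _. now rewrite H.
Qed.

Lemma sphere_mean_plus (k l : R3 -> R) : cont k -> cont l ->
  sphere_mean (fun om => k om + l om) = sphere_mean k + sphere_mean l.
Proof.
  intros Hk Hl. unfold sphere_mean.
  rewrite <- (RInt_plus (V := R_CompleteNormedModule)); try now apply ex_RInt_sphere_outer.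
  apply RInt_ext. intros th _.
  rewrite <- (RInt_plus (V := R_CompleteNormedModule)); try now apply ex_RInt_sphere_inner.
  apply RInt_ext. intros ph _. unfold plus; simpl. ring.
Qed.

Lemma sphere_mean_scal (c : R) (k : R3 -> R) : cont k ->
  sphere_mean (fun om => c * k om) = c * sphere_mean k.
Proof.
  intros Hk. unfold sphere_mean.
  rewrite <- (RInt_scal (V := R_CompleteNormedModule)); try now apply ex_RInt_sphere_outer.
  apply RInt_ext. intros th _.
  rewrite <- (RInt_scal (V := R_CompleteNormedModule)); try now apply ex_RInt_sphere_inner.
  apply RInt_ext. intros ph _. unfold scal; simpl. unfold mult; simpl. ring.
Qed.

Lemma sphere_mean_const (c : R) : sphere_mean (fun _ => c) = c.
Proof.
  unfold sphere_mean. pose proof PI_RGT_0.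
  rewrite (RInt_ext _ (fun th => c / 2 * sin th)).
  2:{ intros th _. rewrite RInt_const. unfold scal; simpl; unfold mult; simpl. field. lra. }
  assert (HI : is_RInt (fun th => c / 2 * sin th) 0 PI
    (minus (- (c / 2) * cos PI) (- (c / 2) * cos 0))).
  { apply (is_RInt_derive (fun th => - (c / 2) * cos th) (fun th => c / 2 * sin th)).
    - intros x _. auto_derive; auto. ring.
    - intros x _. revert x. change (cont (fun th => c / 2 * sin th)). cont_tac. }
  rewrite cos_PI, cos_0 in HI. rewrite (is_RInt_unique _ _ _ _ HI).
  unfold minus, plus, opp; simpl. field.
Qed.

Lemma sphere_point_norm (th ph : R) :
  (sin th * cos ph) ^ 2 + (sin th * sin ph) ^ 2 + cos th ^ 2 = 1.
Proof.
  pose proof (sin2_cos2 th) as H1. pose proof (sin2_cos2 ph) as H2. unfold Rsqr in *.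
  replace ((sin th * cos ph) ^ 2 + (sin th * sin ph) ^ 2 + cos th ^ 2) with
    (sin th * sin th * (sin ph * sin ph + cos ph * cos ph) + cos th * cos th) by ring.
  rewrite H2. lra.
Qed.

Lemma sphere_mean_le (k l : R3 -> R) : cont k -> cont l ->
  (forall x y z, x ^ 2 + y ^ 2 + z ^ 2 = 1 -> k (x, y, z) <= l (x, y, z)) ->
  sphere_mean k <= sphere_mean l.
Proof.
  intros Hk Hl H. pose proof PI_RGT_0.
  apply RInt_le; try now apply ex_RInt_sphere_outer. lra.
  intros th Hth. apply RInt_le; try now apply ex_RInt_sphere_inner. lra.
  intros ph _. apply Rmult_le_compat_l.
  - apply Rmult_le_pos; [now apply Rlt_le, sin_gt_0|].
    apply Rlt_le, Rinv_0_lt_compat. lra.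
  - apply H, sphere_point_norm.
Qed.

Lemma is_derive_sphere_mean (k dk : R -> R3 -> R) (s : R) :
  (forall om s, is_derive (fun s => k s om) s (dk s om)) ->
  cont (fun q : R * R3 => k (fst q) (snd q)) ->
  cont (fun q : R * R3 => dk (fst q) (snd q)) ->
  is_derive (fun s => sphere_mean (k s)) s (sphere_mean (dk s)).
Proof.
  intros Hd Hk Hdk.
  apply (is_derive_RInt_cont
    (fun s th => RInt (fun ph => sin th * / (4 * PI) * k s (sphere_point th ph)) 0 (2 * PI))
    (fun s th => RInt (fun ph => sin th * / (4 * PI) * dk s (sphere_point th ph)) 0 (2 * PI))).
  - intros h th. apply (is_derive_RInt_cont
      (fun s ph => sin th * / (4 * PI) * k s (sphere_point th ph))
      (fun s ph => sin th * / (4 * PI) * dk s (sphere_point th ph))).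
    + intros s' ph. apply (is_derive_scal (fun s => k s (sphere_point th ph)) s'
        (sin th * / (4 * PI))). apply Hd.
    + unfold sphere_point. cont_tac.
    + unfold sphere_point. cont_tac.
  - now apply cont_sphere_inner.
  - now apply cont_sphere_inner.
Qed.

Lemma has_partial_sphere_mean {E : NormedModule R_AbsRing} (v : E) (k dk : E -> R3 -> R) (p : E) :
  (forall om p, has_partial v (fun p => k p om) p (dk p om)) ->
  cont (fun q : E * R3 => k (fst q) (snd q)) ->
  cont (fun q : E * R3 => dk (fst q) (snd q)) ->
  has_partial v (fun p => sphere_mean (k p)) p (sphere_mean (dk p)).
Proof.
  intros Hd Hk Hdk.
  assert (Hline : cont (fun h : R => plus p (scal h v))).
  { intros h. apply continuous_slice_arg. }
  unfold has_partial.
  replace (dk p) with (dk (plus p (scal 0 v))) by (rewrite scal_R0; now rewrite plus_zero_r).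
  apply (is_derive_sphere_mean (fun h om => k (plus p (scal h v)) om)
    (fun h om => dk (plus p (scal h v)) om)).
  - intros om s. apply (has_partial_along v (fun p => k p om) p s). apply Hd.
  - apply (cont_comp2 (fun q : R * R3 => plus p (scal (fst q) v)) snd k); auto.
    + apply (cont_comp fst (fun h : R => plus p (scal h v))); auto. apply cont_fst.
    + apply cont_snd.
  - apply (cont_comp2 (fun q : R * R3 => plus p (scal (fst q) v)) snd dk); auto.
    + apply (cont_comp fst (fun h : R => plus p (scal h v))); auto. apply cont_fst.
    + apply cont_snd.
Qed.

(** * Symmetry of second derivatives *)

Lemma open_everywhere {E : UniformSpace} : open (everywhere : E -> Prop).
Proof. intros x _. now apply filter_forall. Qed.

Section Symmetry.
Context {E : NormedModule R_AbsRing}.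
Variables (basis : list E) (g : E -> R).
Hypothesis Hg : class_C 2 basis everywhere g.

(** Reduces to functions of two real variables by restricting [g] to the plane
    through [p] spanned by [v] and [w]. *)
Lemma partial_comm (v w p : E) : In v basis -> In w basis ->
  partial v (partial w g) p = partial w (partial v g) p.
Proof.
  intros Hv Hw.
  set (P := fun z b : R => plus (plus p (scal z v)) (scal b w)).
  assert (PC : forall z b, P z b = plus (plus p (scal b w)) (scal z v)).
  { intros z b. unfold P. rewrite <- !plus_assoc. f_equal. apply plus_comm. }
  assert (contP : cont (fun q : R * R => P (fst q) (snd q))).
  { intros q. unfold P.
    apply (continuous_plus (fun q : R * R => plus p (scal (fst q) v))
                           (fun q : R * R => scal (snd q) w)).
    - apply (continuous_plus (fun _ : R * R => p) (fun q : R * R => scal (fst q) v)).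
      apply continuous_const.
      apply (continuous_scal_l (fun q : R * R => fst q) v). apply cont_fst.
    - apply (continuous_scal_l (fun q : R * R => snd q) w). apply cont_snd. }
  assert (Dw : forall k : E -> R, class_C 1 basis everywhere k -> forall z b,
            is_derive (fun b => k (P z b)) b (partial w k (P z b))).
  { intros k Hk z b. apply (has_partial_along w k (plus p (scal z v)) b).
    now apply (class_C_has_partial 0 basis everywhere). }
  assert (Dv : forall k : E -> R, class_C 1 basis everywhere k -> forall z b,
            is_derive (fun z => k (P z b)) z (partial v k (P z b))).
  { intros k Hk z b.
    apply (is_derive_ext (fun z => k (plus (plus p (scal b w)) (scal z v)))).
    { intros t. now rewrite PC. }
    rewrite PC. apply (has_partial_along v k (plus p (scal b w)) z).
    now apply (class_C_has_partial 0 basis everywhere). }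
  assert (G1 : class_C 1 basis everywhere g) by now apply class_C_weaken.
  assert (Gv : class_C 1 basis everywhere (partial v g))
    by (apply class_C_partial; auto using open_everywhere).
  assert (Gw : class_C 1 basis everywhere (partial w g))
    by (apply class_C_partial; auto using open_everywhere).
  assert (Cvw : cont (partial v (partial w g))).
  { intros q. apply (class_C_continuous 0 basis everywhere); [|exact I].
    apply class_C_partial; auto using open_everywhere. }
  assert (Cwv : cont (partial w (partial v g))).
  { intros q. apply (class_C_continuous 0 basis everywhere); [|exact I].
    apply class_C_partial; auto using open_everywhere. }
  assert (Evw : forall z b, is_derive (fun z => Derive (fun t => g (P z t)) b) z
                  (partial v (partial w g) (P z b))).
  { intros z b. apply (is_derive_ext (fun z => partial w g (P z b))); [|now apply Dv].
    intros t. symmetry. now apply is_derive_unique, Dw. }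
  assert (Ewv : forall z b, is_derive (fun b => Derive (fun t => g (P t b)) z) b
                  (partial w (partial v g) (P z b))).
  { intros z b. apply (is_derive_ext (fun b => partial v g (P z b))); [|now apply Dw].
    intros t. symmetry. now apply is_derive_unique, Dv. }
  assert (P0 : P 0 0 = p).
  { unfold P. rewrite !scal_R0. now rewrite !plus_zero_r. }
  rewrite <- P0.
  transitivity (Derive (fun z : R => Derive (fun t : R => g (P z t)) 0) 0).
  { symmetry. apply is_derive_unique, Evw. }
  transitivity (Derive (fun b : R => Derive (fun t : R => g (P t b)) 0) 0).
  2: apply is_derive_unique, Ewv.
  apply (Schwarz (fun z b => g (P z b)) 0 0).
  - exists (mkposreal 1 Rlt_0_1). intros x y _ _. repeat apply conj.
    + eexists; now apply Dv.
    + eexists; now apply Dw.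
    + eexists; apply Evw.
    + eexists; apply Ewv.
  - apply (continuity_2d_pt_ext (fun z b => partial v (partial w g) (P z b))).
    + intros x y. symmetry. apply is_derive_unique, Evw.
    + apply continuity_2d_pt_filterlim.
      apply (cont_comp (fun q : R * R => P (fst q) (snd q)) (partial v (partial w g)) contP Cvw (0, 0)).
  - apply (continuity_2d_pt_ext (fun z b => partial w (partial v g) (P z b))).
    + intros x y. symmetry. apply is_derive_unique, Ewv.
    + apply continuity_2d_pt_filterlim.
      apply (cont_comp (fun q : R * R => P (fst q) (snd q)) (partial w (partial v g)) contP Cwv (0, 0)).
Qed.
End Symmetry.

(** * Spherical means *)

(** For [p = (x, t)] this is x + t om: the sphere of radius |t| around x when
    om runs over unit vectors. *)
Definition ray (p : R31) (om : R3) : R3 :=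
  (fst (fst (fst p)) + snd p * fst (fst om),
   snd (fst (fst p)) + snd p * snd (fst om),
   snd (fst p) + snd p * snd om).

Lemma cont_ray : cont (fun q : R31 * R3 => ray (fst q) (snd q)).
Proof. unfold ray. cont_tac. Qed.

Lemma triple_eq (a b c a' b' c' : R) : a = a' -> b = b' -> c = c' -> (a, b, c) = (a', b', c').
Proof. now intros -> -> ->. Qed.

Lemma has_partial_ray_x (g : R3 -> R) (p : R31) (om : R3) (l : R) :
  (has_partial e1 g (ray p om) l -> has_partial dx1 (fun p => g (ray p om)) p l) /\
  (has_partial e2 g (ray p om) l -> has_partial dx2 (fun p => g (ray p om)) p l) /\
  (has_partial e3 g (ray p om) l -> has_partial dx3 (fun p => g (ray p om)) p l).
Proof.
  destruct p as [[[x y] z] t], om as [[a b] c].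
  split; [|split].
  - apply is_derive_ext; intros h.
    change (g (x + t * a + h * 1, y + t * b + h * 0, z + t * c + h * 0)
      = g (x + h * 1 + (t + h * 0) * a, y + h * 0 + (t + h * 0) * b, z + h * 0 + (t + h * 0) * c)).
    f_equal. apply triple_eq; ring.
  - apply is_derive_ext; intros h.
    change (g (x + t * a + h * 0, y + t * b + h * 1, z + t * c + h * 0)
      = g (x + h * 0 + (t + h * 0) * a, y + h * 1 + (t + h * 0) * b, z + h * 0 + (t + h * 0) * c)).
    f_equal. apply triple_eq; ring.
  - apply is_derive_ext; intros h.
    change (g (x + t * a + h * 0, y + t * b + h * 0, z + t * c + h * 1)
      = g (x + h * 0 + (t + h * 0) * a, y + h * 0 + (t + h * 0) * b, z + h * 1 + (t + h * 0) * c)).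
    f_equal. apply triple_eq; ring.
Qed.

Lemma has_partial_ray_t (g g1 g2 g3 : R3 -> R) (p : R31) (om : R3) :
  (forall p, has_partial e1 g p (g1 p)) ->
  (forall p, has_partial e2 g p (g2 p)) ->
  (forall p, has_partial e3 g p (g3 p)) ->
  cont g1 -> cont g2 ->
  has_partial dt (fun p => g (ray p om)) p
    (fst (fst om) * g1 (ray p om) + (snd (fst om) * g2 (ray p om) + snd om * g3 (ray p om))).
Proof.
  intros H1 H2 H3 C1 C2.
  destruct p as [[[x y] z] t], om as [[a b] c]; simpl.
  pose proof (is_derive_along_curve g g1 g2 g3 (fun s => x + (t + s) * a) (fun s => y + (t + s) * b)
    (fun s => z + (t + s) * c) (fun _ => a) (fun _ => b) (fun _ => c) 0 H1 H2 H3 C1 C2) as H.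
  unfold ray; simpl. cbv beta in H. rewrite Rplus_0_r in H.
  unfold has_partial. eapply is_derive_ext; [|apply H].
  - intros s.
    change (g (x + (t + s) * a, y + (t + s) * b, z + (t + s) * c)
      = g (x + s * 0 + (t + s * 1) * a, y + s * 0 + (t + s * 1) * b, z + s * 0 + (t + s * 1) * c)).
    f_equal. apply triple_eq; ring.
  - intros s. auto_derive; auto; ring.
  - intros s. auto_derive; auto; ring.
  - intros s. auto_derive; auto; ring.
  - cont_tac.
  - cont_tac.
Qed.

Definition weighted_mean (h g : R3 -> R) (p : R31) : R :=
  sphere_mean (fun om => h om * g (ray p om)).

Lemma cont_weighted_integrand (h g : R3 -> R) : cont h -> cont g ->
  cont (fun q : R31 * R3 => h (snd q) * g (ray (fst q) (snd q))).
Proof.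
  intros Hh Hg. apply cont_mult; [cont_tac|].
  apply (cont_comp (fun q : R31 * R3 => ray (fst q) (snd q)) g cont_ray Hg).
Qed.

Lemma cont_weighted_slice (h g : R3 -> R) (p : R31) : cont h -> cont g ->
  cont (fun om => h om * g (ray p om)).
Proof.
  intros Hh Hg. apply (cont_section (fun p om => h om * g (ray p om)) p).
  now apply cont_weighted_integrand.
Qed.

Lemma cont_weighted_mean (h g : R3 -> R) : cont h -> cont g -> cont (weighted_mean h g).
Proof.
  intros Hh Hg. apply (cont_sphere_mean (fun p om => h om * g (ray p om))).
  now apply cont_weighted_integrand.
Qed.

Lemma weighted_mean_plus (h g k : R3 -> R) (p : R31) : cont h -> cont g -> cont k ->
  weighted_mean h (fun x => g x + k x) p = weighted_mean h g p + weighted_mean h k p.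
Proof.
  intros Hh Hg Hk. unfold weighted_mean. rewrite <- sphere_mean_plus; auto using cont_weighted_slice.
  apply sphere_mean_ext. intros om. ring.
Qed.

Lemma weighted_mean_ext (h h' g g' : R3 -> R) (p : R31) :
  (forall x, h x = h' x) -> (forall x, g x = g' x) -> weighted_mean h g p = weighted_mean h' g' p.
Proof. intros H1 H2. apply sphere_mean_ext. intros om. now rewrite H1, H2. Qed.

Section WeightedMean.
Variables (h g g1 g2 g3 : R3 -> R).
Hypotheses (Hh : cont h) (Hg : cont g) (Hg1 : cont g1) (Hg2 : cont g2) (Hg3 : cont g3).
Hypotheses (P1 : forall p, has_partial e1 g p (g1 p))
  (P2 : forall p, has_partial e2 g p (g2 p)) (P3 : forall p, has_partial e3 g p (g3 p)).

Lemma has_partial_weighted_mean_x (p : R31) :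
  has_partial dx1 (weighted_mean h g) p (weighted_mean h g1 p) /\
  has_partial dx2 (weighted_mean h g) p (weighted_mean h g2 p) /\
  has_partial dx3 (weighted_mean h g) p (weighted_mean h g3 p).
Proof.
  split; [|split].
  - apply (has_partial_sphere_mean dx1 (fun p om => h om * g (ray p om))
      (fun p om => h om * g1 (ray p om))); try now apply cont_weighted_integrand.
    intros om q. apply (is_derive_scal (slice (fun q => g (ray q om)) q dx1) 0 (h om)).
    exact (proj1 (has_partial_ray_x g q om (g1 (ray q om))) (P1 _)).
  - apply (has_partial_sphere_mean dx2 (fun p om => h om * g (ray p om))
      (fun p om => h om * g2 (ray p om))); try now apply cont_weighted_integrand.
    intros om q. apply (is_derive_scal (slice (fun q => g (ray q om)) q dx2) 0 (h om)).
    exact (proj1 (proj2 (has_partial_ray_x g q om (g2 (ray q om)))) (P2 _)).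
  - apply (has_partial_sphere_mean dx3 (fun p om => h om * g (ray p om))
      (fun p om => h om * g3 (ray p om))); try now apply cont_weighted_integrand.
    intros om q. apply (is_derive_scal (slice (fun q => g (ray q om)) q dx3) 0 (h om)).
    exact (proj2 (proj2 (has_partial_ray_x g q om (g3 (ray q om)))) (P3 _)).
Qed.

Lemma cont_coord1 : cont (fun om : R3 => h om * fst (fst om)). Proof. cont_tac. Qed.
Lemma cont_coord2 : cont (fun om : R3 => h om * snd (fst om)). Proof. cont_tac. Qed.
Lemma cont_coord3 : cont (fun om : R3 => h om * snd om). Proof. cont_tac. Qed.

Lemma has_partial_weighted_mean_t (p : R31) :
  has_partial dt (weighted_mean h g) p
    (weighted_mean (fun om => h om * fst (fst om)) g1 p
     + (weighted_mean (fun om => h om * snd (fst om)) g2 p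
        + weighted_mean (fun om => h om * snd om) g3 p)).
Proof.
  pose proof cont_coord1 as W1. pose proof cont_coord2 as W2. pose proof cont_coord3 as W3.
  unfold weighted_mean.
  rewrite <- !sphere_mean_plus; auto using cont_weighted_slice, cont_plus.
  apply (has_partial_sphere_mean dt (fun p om => h om * g (ray p om))
    (fun p om => h om * fst (fst om) * g1 (ray p om) + (h om * snd (fst om) * g2 (ray p om)
       + h om * snd om * g3 (ray p om)))).
  - intros om q.
    pose proof (is_derive_scal (slice (fun q => g (ray q om)) q dt) 0 (h om) _
      (has_partial_ray_t g g1 g2 g3 q om P1 P2 P3 Hg1 Hg2)) as H.
    unfold has_partial.
    match type of H with is_derive _ _ ?l => match goal with |- is_derive _ _ ?l' =>
      replace l' with l by ring end end.
    exact H.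
  - now apply cont_weighted_integrand.
  - repeat apply cont_plus.
    + now apply (cont_weighted_integrand (fun om => h om * fst (fst om))).
    + now apply (cont_weighted_integrand (fun om => h om * snd (fst om))).
    + now apply (cont_weighted_integrand (fun om => h om * snd om)).
Qed.
End WeightedMean.

(** * The Laplacian under a spherical mean *)

(** Reading a sum of means as the mean of one integrand is done syntactically
    through this relation, which carries the continuity required by
    additivity. *)
Definition has_mean (k : R3 -> R) (u : R) : Prop := cont k /\ sphere_mean k = u.

Lemma has_mean_plus k l u v :
  has_mean k u -> has_mean l v -> has_mean (fun om => k om + l om) (u + v).
Proof. intros [K1 <-] [L1 <-]. split; [now apply cont_plus|now apply sphere_mean_plus]. Qed.

Lemma has_mean_scal c k u : has_mean k u -> has_mean (fun om => c * k om) (c * u).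
Proof.
  intros [K1 <-]. split; [apply cont_mult; auto; apply cont_const|now apply sphere_mean_scal].
Qed.

Lemma has_mean_weighted h g p : cont h -> cont g ->
  has_mean (fun om => h om * g (ray p om)) (weighted_mean h g p).
Proof. intros Hh Hg. split; [now apply cont_weighted_slice|reflexivity]. Qed.

Lemma has_mean_unique k l u v :
  has_mean k u -> has_mean l v -> (forall om, k om = l om) -> u = v.
Proof. intros [_ <-] [_ <-]. apply sphere_mean_ext. Qed.

Definition one3 : R3 -> R := fun _ => 1.
Lemma cont_one3 : cont one3.
Proof. apply cont_const. Qed.

Lemma is_derive_theta_part (u1 u2 u3 : R -> R) (d1 d2 d3 k c s th : R) :
  is_derive u1 th d1 -> is_derive u2 th d2 -> is_derive u3 th d3 ->
  is_derive (fun th => k * (sin th * (cos th * (c * u1 th + s * u2 th) - sin th * u3 th))) th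
    (k * (cos th * (cos th * (c * u1 th + s * u2 th) - sin th * u3 th)
      + sin th * (- sin th * (c * u1 th + s * u2 th) - cos th * u3 th)
      + sin th * (cos th * (c * d1 + s * d2) - sin th * d3))).
Proof.
  intros D1 D2 D3. auto_derive.
  - repeat apply conj; try exact I; eexists; eassumption.
  - rewrite (is_derive_unique (fun x : R => u1 x) _ _ D1 : Derive (fun x : R => u1 x) _ = _), (is_derive_unique (fun x : R => u2 x) _ _ D2 : Derive (fun x : R => u2 x) _ = _),
      (is_derive_unique (fun x : R => u3 x) _ _ D3 : Derive (fun x : R => u3 x) _ = _). ring.
Qed.

Lemma is_derive_phi_part (u1 u2 : R -> R) (d1 d2 k ph : R) :
  is_derive u1 ph d1 -> is_derive u2 ph d2 ->
  is_derive (fun ph => k * (- sin ph * u1 ph + cos ph * u2 ph)) ph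
    (k * (- cos ph * u1 ph - sin ph * u2 ph - sin ph * d1 + cos ph * d2)).
Proof.
  intros D1 D2. auto_derive.
  - repeat apply conj; try exact I; eexists; eassumption.
  - rewrite (is_derive_unique (fun x : R => u1 x) _ _ D1 : Derive (fun x : R => u1 x) _ = _), (is_derive_unique (fun x : R => u2 x) _ _ D2 : Derive (fun x : R => u2 x) _ = _). ring.
Qed.

Lemma RInt_antiderivative (f df : R -> R) (a b : R) :
  (forall x, is_derive f x (df x)) -> cont df -> RInt df a b = f b - f a.
Proof.
  intros H Hc. apply is_RInt_unique. apply (is_RInt_derive f df); intros; auto.
Qed.

Section MeanLaplacian.
Variables (G1 G2 G3 G11 G12 G13 G21 G22 G23 G31 G32 G33 : R3 -> R).
Hypotheses (P11 : forall p, has_partial e1 G1 p (G11 p))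
  (P12 : forall p, has_partial e2 G1 p (G12 p)) (P13 : forall p, has_partial e3 G1 p (G13 p))
  (P21 : forall p, has_partial e1 G2 p (G21 p)) (P22 : forall p, has_partial e2 G2 p (G22 p))
  (P23 : forall p, has_partial e3 G2 p (G23 p)) (P31 : forall p, has_partial e1 G3 p (G31 p))
  (P32 : forall p, has_partial e2 G3 p (G32 p)) (P33 : forall p, has_partial e3 G3 p (G33 p)).
Hypotheses (C1 : cont G1) (C2 : cont G2) (C3 : cont G3)
  (C11 : cont G11) (C12 : cont G12) (C13 : cont G13)
  (C21 : cont G21) (C22 : cont G22) (C23 : cont G23)
  (C31 : cont G31) (C32 : cont G32) (C33 : cont G33).

(** The integrand is d^2/dt^2 (t g(x + t om)) - t Delta g(x + t om), where G_i
    stands for the i-th derivative of g and G_ij for the j-th derivative of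
    G_i. The tangential part of the Laplacian is a divergence on the sphere,
    so it has mean zero. *)
Lemma sphere_mean_laplacian (p : R31) :
  sphere_mean (fun om =>
    2 * (fst (fst om) * G1 (ray p om) + snd (fst om) * G2 (ray p om) + snd om * G3 (ray p om))
    + snd p * (fst (fst om) * (fst (fst om) * G11 (ray p om) + snd (fst om) * G12 (ray p om)
                               + snd om * G13 (ray p om))
      + snd (fst om) * (fst (fst om) * G21 (ray p om) + snd (fst om) * G22 (ray p om)
                               + snd om * G23 (ray p om))
      + snd om * (fst (fst om) * G31 (ray p om) + snd (fst om) * G32 (ray p om)
                               + snd om * G33 (ray p om)))
    - snd p * (G11 (ray p om) + G22 (ray p om) + G33 (ray p om))) = 0.
Proof.
  destruct p as [[[x y] z] t]. unfold ray; simpl fst; simpl snd.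
  set (q := fun th ph => (x + t * (sin th * cos ph), y + t * (sin th * sin ph), z + t * cos th) : R3).
  assert (Dth : forall g g1 g2 g3 : R3 -> R, (forall p, has_partial e1 g p (g1 p)) ->
    (forall p, has_partial e2 g p (g2 p)) -> (forall p, has_partial e3 g p (g3 p)) ->
    cont g1 -> cont g2 -> forall th ph, is_derive (fun th => g (q th ph)) th
     (t * (cos th * cos ph) * g1 (q th ph) + (t * (cos th * sin ph) * g2 (q th ph)
       + t * (- sin th) * g3 (q th ph)))).
  { intros g g1 g2 g3 Q1 Q2 Q3 K1 K2 th ph.
    apply (is_derive_along_curve g g1 g2 g3 (fun th => x + t * (sin th * cos ph))
      (fun th => y + t * (sin th * sin ph)) (fun th => z + t * cos th)
      (fun th => t * (cos th * cos ph)) (fun th => t * (cos th * sin ph)) (fun th => t * (- sin th)));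
      auto; try (intros s; auto_derive; auto; ring); cont_tac. }
  assert (Dph : forall g g1 g2 g3 : R3 -> R, (forall p, has_partial e1 g p (g1 p)) ->
    (forall p, has_partial e2 g p (g2 p)) -> (forall p, has_partial e3 g p (g3 p)) ->
    cont g1 -> cont g2 -> forall th ph, is_derive (fun ph => g (q th ph)) ph
     (t * (sin th * - sin ph) * g1 (q th ph) + (t * (sin th * cos ph) * g2 (q th ph)
       + 0 * g3 (q th ph)))).
  { intros g g1 g2 g3 Q1 Q2 Q3 K1 K2 th ph.
    apply (is_derive_along_curve g g1 g2 g3 (fun ph => x + t * (sin th * cos ph))
      (fun ph => y + t * (sin th * sin ph)) (fun ph => z + t * cos th)
      (fun ph => t * (sin th * - sin ph)) (fun ph => t * (sin th * cos ph)) (fun ph => 0));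
      auto; try (intros s; auto_derive; auto; ring); cont_tac. }
  assert (Cq : cont (fun u : R * R => q (fst u) (snd u))).
  { unfold q. cont_tac. }
  assert (Cq' : forall th, cont (q th)).
  { intros th. unfold q. cont_tac. }
  (* The integrand times the area density is d_th (A) + d_ph (B), where, up to
     the factor 1 / (4 PI), A is - sin th times the derivative of g along
     the unit vector d_th (om) and B is minus its derivative along the horizontal
     unit vector (- sin ph, cos ph, 0).  A vanishes at both poles and B is
     periodic in ph. *)
  set (A := fun th ph => - / (4 * PI) * (sin th * (cos th * (cos ph * G1 (q th ph) + sin ph * G2 (q th ph))
                        - sin th * G3 (q th ph)))).
  set (dA := fun th ph => - / (4 * PI) *
     (cos th * (cos th * (cos ph * G1 (q th ph) + sin ph * G2 (q th ph)) - sin th * G3 (q th ph))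
    + sin th * (- sin th * (cos ph * G1 (q th ph) + sin ph * G2 (q th ph)) - cos th * G3 (q th ph))
    + sin th * (cos th * (cos ph *
          (t * (cos th * cos ph) * G11 (q th ph) + (t * (cos th * sin ph) * G12 (q th ph)
            + t * (- sin th) * G13 (q th ph)))
        + sin ph *
          (t * (cos th * cos ph) * G21 (q th ph) + (t * (cos th * sin ph) * G22 (q th ph)
            + t * (- sin th) * G23 (q th ph))))
        - sin th *
          (t * (cos th * cos ph) * G31 (q th ph) + (t * (cos th * sin ph) * G32 (q th ph)
            + t * (- sin th) * G33 (q th ph)))))).
  set (B := fun th ph => - / (4 * PI) * (- sin ph * G1 (q th ph) + cos ph * G2 (q th ph))).
  set (dB := fun th ph => - / (4 * PI) *
     (- cos ph * G1 (q th ph) - sin ph * G2 (q th ph)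
      - sin ph * (t * (sin th * - sin ph) * G11 (q th ph) + (t * (sin th * cos ph) * G12 (q th ph)
       + 0 * G13 (q th ph)))
      + cos ph * (t * (sin th * - sin ph) * G21 (q th ph) + (t * (sin th * cos ph) * G22 (q th ph)
       + 0 * G23 (q th ph))))).
  assert (HA : forall th ph, is_derive (fun th => A th ph) th (dA th ph)).
  { intros th ph. unfold A, dA.
    apply (is_derive_theta_part (fun th => G1 (q th ph)) (fun th => G2 (q th ph)) (fun th => G3 (q th ph)));
      auto. }
  assert (HB : forall th ph, is_derive (B th) ph (dB th ph)).
  { intros th ph. unfold B, dB.
    apply (is_derive_phi_part (fun ph => G1 (q th ph)) (fun ph => G2 (q th ph))); auto. }
  assert (CA : cont (fun u : R * R => A (fst u) (snd u))).
  { unfold A. cont_tac. }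
  assert (CdA : cont (fun u : R * R => dA (fst u) (snd u))).
  { unfold dA. cont_tac. }
  assert (CdB : forall th, cont (dB th)).
  { intros th. unfold dB. cont_tac; apply Cq'. }
  unfold sphere_mean.
  transitivity (RInt (fun th => RInt (dA th) 0 (2 * PI)) 0 PI).
  - apply RInt_ext. intros th _.
    transitivity (RInt (fun ph => dA th ph + dB th ph) 0 (2 * PI)).
    + apply RInt_ext. intros ph _. unfold sphere_point; simpl fst; simpl snd.
      fold (q th ph). unfold dA, dB.
      assert (E1 : sin th * sin th = 1 - cos th * cos th)
        by (pose proof (sin2_cos2 th); unfold Rsqr in *; lra).
      assert (E2 : sin ph * sin ph = 1 - cos ph * cos ph)
        by (pose proof (sin2_cos2 ph); unfold Rsqr in *; lra).
      match goal with |- ?a = ?b => change (@eq R a b) end.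
      ring [E1 E2].
    + rewrite (RInt_plus (V := R_CompleteNormedModule) (dA th) (dB th));
        try apply ex_RInt_cont; auto. 2: apply (cont_section _ _ CdA).
      rewrite (RInt_antiderivative (B th) (dB th)); auto.
      unfold B, q. rewrite sin_2PI, cos_2PI, sin_0, cos_0.
      unfold Rminus. rewrite Rplus_opp_r. apply (plus_zero_r (RInt (dA th) 0 (2 * PI))).
  - rewrite (RInt_antiderivative (fun th => RInt (A th) 0 (2 * PI)) (fun th => RInt (dA th) 0 (2 * PI))).
    2: intros th; now apply is_derive_RInt_cont.
    2: apply cont_RInt_param; auto using two_PI_ge_0.
    assert (H0 : forall th, sin th = 0 -> RInt (A th) 0 (2 * PI) = 0).
    { intros th Hs. rewrite (RInt_ext _ (fun _ => 0)).
      - rewrite RInt_const. apply (Rmult_0_r (2 * PI - 0)).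
      - intros ph _. unfold A. rewrite Hs. change (@eq R (- / (4 * PI) * (0 * (cos th * (cos ph * G1 (q th ph) + sin ph * G2 (q th ph)) - 0 * G3 (q th ph)))) 0). ring. }
    rewrite (H0 PI), (H0 0) by auto using sin_0, sin_PI. apply Rminus_0_r.
Qed.

(** The previous identity, with the left-hand side arranged as it comes out of
    differentiating twice in time under the integral sign. *)
Lemma weighted_mean_laplacian (p : R31) :
  weighted_mean (fun om => one3 om * fst (fst om)) G1 p
  + (weighted_mean (fun om => one3 om * snd (fst om)) G2 p
     + weighted_mean (fun om => one3 om * snd om) G3 p)
  + (1 * (weighted_mean (fun om => one3 om * fst (fst om)) G1 p
         + (weighted_mean (fun om => one3 om * snd (fst om)) G2 p
            + weighted_mean (fun om => one3 om * snd om) G3 p))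
    + snd p * ((weighted_mean (fun om => one3 om * fst (fst om) * fst (fst om)) G11 p
        + (weighted_mean (fun om => one3 om * fst (fst om) * snd (fst om)) G12 p
           + weighted_mean (fun om => one3 om * fst (fst om) * snd om) G13 p))
      + ((weighted_mean (fun om => one3 om * snd (fst om) * fst (fst om)) G21 p
          + (weighted_mean (fun om => one3 om * snd (fst om) * snd (fst om)) G22 p
             + weighted_mean (fun om => one3 om * snd (fst om) * snd om) G23 p))
        + (weighted_mean (fun om => one3 om * snd om * fst (fst om)) G31 p
          + (weighted_mean (fun om => one3 om * snd om * snd (fst om)) G32 p
             + weighted_mean (fun om => one3 om * snd om * snd om) G33 p)))))
  = snd p * weighted_mean one3 (fun x => G11 x + G22 x + G33 x) p.
Proof.
  pose proof cont_one3 as cone.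
  assert (cr : cont (ray p)) by (unfold ray; cont_tac).
  rewrite <- (Rplus_0_r (snd p * weighted_mean _ _ _)).
  eapply has_mean_unique.
  - repeat lazymatch goal with
        | |- has_mean _ (_ + _) => eapply has_mean_plus
        | |- has_mean _ (_ * _) => eapply has_mean_scal
        | |- has_mean _ (weighted_mean _ _ _) => eapply has_mean_weighted
        end; cont_tac.
  - eapply has_mean_plus.
    + eapply has_mean_scal, has_mean_weighted; cont_tac.
    + refine (conj _ (sphere_mean_laplacian p)). cont_tac.
  - intros om. unfold one3. cbv beta. ring.
Qed.
End MeanLaplacian.

(** * Kirchhoff's formula *)

Definition smooth3 (g : R3 -> R) : Prop := forall n, class_C n basis3 everywhere g.
Definition smooth31 (g : R31 -> R) : Prop := forall n, class_C n basis31 everywhere g.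

Lemma in_basis3 : In e1 basis3 /\ In e2 basis3 /\ In e3 basis3.
Proof. unfold basis3; simpl; auto 6. Qed.

Section Smooth3.
Variable g : R3 -> R.
Hypothesis Hg : smooth3 g.

Lemma smooth3_cont : cont g.
Proof. intros p. now apply (class_C_continuous 0 basis3 everywhere). Qed.

Lemma smooth3_partial v : In v basis3 -> smooth3 (partial v g).
Proof. intros Hv n. apply class_C_partial; auto. apply open_everywhere. Qed.

Lemma smooth3_has_partial v p : In v basis3 -> has_partial v g p (partial v g p).
Proof. intros Hv. now apply (class_C_has_partial 0 basis3 everywhere). Qed.
End Smooth3.

Lemma smooth3_plus g k : smooth3 g -> smooth3 k -> smooth3 (fun x => g x + k x).
Proof. intros Hg Hk n. now apply class_C_plus. Qed.

Lemma partial_plus3 g k v p : smooth3 g -> smooth3 k -> In v basis3 ->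
  partial v (fun x => g x + k x) p = partial v g p + partial v k p.
Proof.
  intros Hg Hk Hv. apply partial_eq.
  apply (is_derive_plus (slice g p v) (slice k p v) 0); now apply smooth3_has_partial.
Qed.

Lemma class_C_weighted_mean n : forall h g : R3 -> R, cont h ->
  class_C n basis3 everywhere g -> class_C n basis31 everywhere (weighted_mean h g).
Proof.
  induction n as [|n IH]; intros h g Hh Hg.
  all: assert (cg : cont g)
         by (intros p; apply (class_C_continuous _ basis3 everywhere _ _ Hg I)).
  all: split; [intros p _; now apply cont_weighted_mean|auto].
  destruct Hg as [_ Hd]. destruct in_basis3 as [B1 [B2 B3]].
  destruct (Hd _ B1) as [g1 [P1 K1]], (Hd _ B2) as [g2 [P2 K2]], (Hd _ B3) as [g3 [P3 K3]].
  assert (c1 : cont g1) by (intros p; apply (class_C_continuous _ basis3 everywhere _ _ K1 I)).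
  assert (c2 : cont g2) by (intros p; apply (class_C_continuous _ basis3 everywhere _ _ K2 I)).
  assert (c3 : cont g3) by (intros p; apply (class_C_continuous _ basis3 everywhere _ _ K3 I)).
  assert (Q1 : forall p, has_partial e1 g p (g1 p)) by (intros p; now apply P1).
  assert (Q2 : forall p, has_partial e2 g p (g2 p)) by (intros p; now apply P2).
  assert (Q3 : forall p, has_partial e3 g p (g3 p)) by (intros p; now apply P3).
  pose proof (has_partial_weighted_mean_x h g g1 g2 g3 Hh cg c1 c2 c3 Q1 Q2 Q3) as HX.
  intros v [<-|[<-|[<-|[<-|[]]]]].
  - exists (weighted_mean h g1). split; auto. intros p _. exact (proj1 (HX p)).
  - exists (weighted_mean h g2). split; auto. intros p _. exact (proj1 (proj2 (HX p))).
  - exists (weighted_mean h g3). split; auto. intros p _. exact (proj2 (proj2 (HX p))).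
  - eexists. split.
    + intros p _. now apply (has_partial_weighted_mean_t h g g1 g2 g3).
    + apply class_C_plus; [|apply class_C_plus]; apply IH; auto;
        [apply cont_coord1|apply cont_coord2|apply cont_coord3]; auto.
Qed.

(** The mean of [h] times the derivative of [g] in the outward direction,
    which is the time derivative of [weighted_mean h g]. *)
Definition radial_mean (h g : R3 -> R) (p : R31) : R :=
  weighted_mean (fun om => h om * fst (fst om)) (partial e1 g) p
  + (weighted_mean (fun om => h om * snd (fst om)) (partial e2 g) p
     + weighted_mean (fun om => h om * snd om) (partial e3 g) p).

Section Means.
Variables (h g : R3 -> R).
Hypotheses (Hh : cont h) (Hg : smooth3 g).
Let B1 : In e1 basis3 := proj1 in_basis3.
Let B2 : In e2 basis3 := proj1 (proj2 in_basis3).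
Let B3 : In e3 basis3 := proj2 (proj2 in_basis3).

Lemma weighted_mean_dx v p : In v basis3 ->
  has_partial (v, 0) (weighted_mean h g) p (weighted_mean h (partial v g) p).
Proof.
  pose proof (has_partial_weighted_mean_x h g (partial e1 g) (partial e2 g) (partial e3 g) Hh
    (smooth3_cont g Hg) (smooth3_cont _ (smooth3_partial g Hg _ B1))
    (smooth3_cont _ (smooth3_partial g Hg _ B2)) (smooth3_cont _ (smooth3_partial g Hg _ B3))
    (fun p => smooth3_has_partial g Hg _ p B1) (fun p => smooth3_has_partial g Hg _ p B2)
    (fun p => smooth3_has_partial g Hg _ p B3) p) as [H1 [H2 H3]].
  intros [<-|[<-|[<-|[]]]]; [exact H1|exact H2|exact H3].
Qed.

Lemma weighted_mean_dt p : has_partial dt (weighted_mean h g) p (radial_mean h g p).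
Proof.
  apply has_partial_weighted_mean_t; auto using smooth3_cont, smooth3_partial, smooth3_has_partial.
Qed.
End Means.

Section RadialMeans.
Variables (h g : R3 -> R).
Hypotheses (Hh : cont h) (Hg : smooth3 g).
Let B1 : In e1 basis3 := proj1 in_basis3.
Let B2 : In e2 basis3 := proj1 (proj2 in_basis3).
Let B3 : In e3 basis3 := proj2 (proj2 in_basis3).

(** The gradient inside the radial mean and the spatial derivative are taken
    in opposite orders on the two sides, so this uses the symmetry of second
    derivatives. *)
Lemma radial_mean_dx v p : In v basis3 ->
  has_partial (v, 0) (radial_mean h g) p (radial_mean h (partial v g) p).
Proof.
  intros Hv.
  assert (HS : forall w h', In w basis3 -> weighted_mean h' (partial w (partial v g)) p
    = weighted_mean h' (partial v (partial w g)) p).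
  { intros w h' Hw. apply weighted_mean_ext; auto. intros x.
    apply (partial_comm basis3); auto. }
  unfold radial_mean. rewrite !HS by auto.
  apply (is_derive_plus (slice (weighted_mean (fun om => h om * fst (fst om)) (partial e1 g)) p (v, 0)));
    [|apply (is_derive_plus (slice (weighted_mean (fun om => h om * snd (fst om)) (partial e2 g)) p (v, 0)))];
    apply weighted_mean_dx; auto using smooth3_partial, cont_coord1, cont_coord2, cont_coord3.
Qed.

Lemma radial_mean_dt p :
  has_partial dt (radial_mean h g) p
    (radial_mean (fun om => h om * fst (fst om)) (partial e1 g) p
     + (radial_mean (fun om => h om * snd (fst om)) (partial e2 g) p
        + radial_mean (fun om => h om * snd om) (partial e3 g) p)).
Proof.
  apply (is_derive_plus (slice (weighted_mean (fun om => h om * fst (fst om)) (partial e1 g)) p dt));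
    [|apply (is_derive_plus (slice (weighted_mean (fun om => h om * snd (fst om)) (partial e2 g)) p dt))];
    apply weighted_mean_dt; auto using smooth3_partial, cont_coord1, cont_coord2, cont_coord3.
Qed.

Lemma class_C_radial_mean n : class_C n basis31 everywhere (radial_mean h g).
Proof.
  apply class_C_plus; [|apply class_C_plus]; apply class_C_weighted_mean;
    auto using cont_coord1, cont_coord2, cont_coord3; now apply smooth3_partial.
Qed.
End RadialMeans.

Lemma radial_mean_plus h g k p : cont h -> smooth3 g -> smooth3 k ->
  radial_mean h (fun x => g x + k x) p = radial_mean h g p + radial_mean h k p.
Proof.
  intros Hh Hg Hk. destruct in_basis3 as [B1 [B2 B3]].
  assert (HS : forall v h', In v basis3 -> cont h' -> weighted_mean h' (partial v (fun x => g x + k x)) p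
    = weighted_mean h' (partial v g) p + weighted_mean h' (partial v k) p).
  { intros v h' Hv Hh'. rewrite <- weighted_mean_plus; auto using smooth3_cont, smooth3_partial.
    apply weighted_mean_ext; auto. intros x. now apply partial_plus3. }
  unfold radial_mean.
  rewrite !HS by auto using cont_coord1, cont_coord2, cont_coord3. ring.
Qed.

Definition lap (g : R3 -> R) : R3 -> R :=
  fun x => partial e1 (partial e1 g) x + partial e2 (partial e2 g) x + partial e3 (partial e3 g) x.

Lemma smooth3_lap g : smooth3 g -> smooth3 (lap g).
Proof.
  intros Hg. destruct in_basis3 as [B1 [B2 B3]].
  apply smooth3_plus; [apply smooth3_plus|]; auto using smooth3_partial.
Qed.

(** A named projection, so that [ring] sees a single atom. *)
Definition time (p : R31) : R := snd p.

(** Solution of the wave equation that starts from 0 with velocity [g]. *)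
Definition velocity_wave (g : R3 -> R) (p : R31) : R := time p * weighted_mean one3 g p.

(** Solution of the wave equation that starts from [g] with velocity 0; it is
    the time derivative of [velocity_wave g]. *)
Definition position_wave (g : R3 -> R) (p : R31) : R :=
  weighted_mean one3 g p + time p * radial_mean one3 g p.

Lemma has_partial_time_x (v : R3) (p : R31) : has_partial ((v, 0) : R31) time p 0.
Proof.
  apply (is_derive_ext (fun _ => time p)).
  - intros t. change (time p = time p + t * 0). ring.
  - apply (is_derive_const (time p)).
Qed.

Lemma has_partial_time_t p : has_partial dt time p 1.
Proof.
  apply (is_derive_ext (fun h => time p + h)).
  - intros t. change (time p + t = time p + t * 1). ring.
  - auto_derive; auto.
Qed.

Lemma has_partial_time_mult v (k : R31 -> R) p l d :
  has_partial v time p d -> has_partial v k p l ->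
  has_partial v (fun p => time p * k p) p (d * k p + time p * l).
Proof.
  intros H1 H2.
  pose proof (is_derive_mult (slice time p v) (slice k p v) 0 d l H1 H2 Rmult_comm) as H.
  rewrite !slice_0 in H. exact H.
Qed.

Lemma has_partial_value {E : NormedModule R_AbsRing} (v : E) (g : E -> R) p l l' :
  has_partial v g p l -> l = l' -> has_partial v g p l'.
Proof. now intros H <-. Qed.

Lemma smooth31_time : smooth31 time.
Proof.
  intros [|n]; (split; [intros p _; exact (cont_snd
    (V := prod_UniformSpace (prod_UniformSpace R_UniformSpace R_UniformSpace) R_UniformSpace)
    (W := R_UniformSpace) p)|]); auto.
  intros v Hv.
  assert (HE : exists d, forall p, has_partial v time p d).
  { destruct Hv as [<-|[<-|[<-|[<-|[]]]]].
    1-3: exists 0; intros; apply has_partial_time_x.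
    exists 1; intros; apply has_partial_time_t. }
  destruct HE as [d Hd]. exists (fun _ => d). split; auto. apply class_C_const.
Qed.

Section Waves.
Variable g : R3 -> R.
Hypothesis Hg : smooth3 g.

Lemma smooth31_velocity_wave : smooth31 (velocity_wave g).
Proof.
  intros n. apply class_C_mult; [apply smooth31_time|].
  apply class_C_weighted_mean; auto using cont_one3.
Qed.

Lemma smooth31_position_wave : smooth31 (position_wave g).
Proof.
  intros n. apply class_C_plus; [|apply class_C_mult; [apply smooth31_time|]].
  - apply class_C_weighted_mean; auto using cont_one3.
  - apply class_C_radial_mean; auto using cont_one3.
Qed.

Lemma velocity_wave_dx v p : In v basis3 ->
  has_partial (v, 0) (velocity_wave g) p (velocity_wave (partial v g) p).
Proof.
  intros Hv. eapply has_partial_value.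
  - apply has_partial_time_mult; [apply has_partial_time_x|].
    apply weighted_mean_dx; auto using cont_one3.
  - unfold velocity_wave. ring.
Qed.

Lemma velocity_wave_dt p : has_partial dt (velocity_wave g) p (position_wave g p).
Proof.
  eapply has_partial_value.
  - apply has_partial_time_mult; [apply has_partial_time_t|].
    apply weighted_mean_dt; auto using cont_one3.
  - unfold position_wave. ring.
Qed.

Lemma position_wave_dx v p : In v basis3 ->
  has_partial (v, 0) (position_wave g) p (position_wave (partial v g) p).
Proof.
  intros Hv. eapply has_partial_value.
  - apply (is_derive_plus (slice (weighted_mean one3 g) p (v, 0))
      (slice (fun p => time p * radial_mean one3 g p) p (v, 0)) 0).
    + apply weighted_mean_dx; auto using cont_one3.
    + apply has_partial_time_mult; [apply has_partial_time_x|].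
      apply radial_mean_dx; auto using cont_one3.
  - unfold position_wave, plus; simpl. ring.
Qed.

(** This is the second time derivative of t M g, so it is where the mean value
    identity for the Laplacian enters. *)
Lemma position_wave_dt p : has_partial dt (position_wave g) p (velocity_wave (lap g) p).
Proof.
  eapply has_partial_value.
  - apply (is_derive_plus (slice (weighted_mean one3 g) p dt)
      (slice (fun p => time p * radial_mean one3 g p) p dt) 0).
    + apply weighted_mean_dt; auto using cont_one3.
    + apply has_partial_time_mult; [apply has_partial_time_t|].
      apply radial_mean_dt; auto using cont_one3.
  - destruct in_basis3 as [B1 [B2 B3]].
    assert (SP : forall v, In v basis3 -> smooth3 (partial v g)) by auto using smooth3_partial.
    assert (SPP : forall v w, In v basis3 -> In w basis3 -> smooth3 (partial v (partial w g)))
      by auto using smooth3_partial.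
    apply (weighted_mean_laplacian (partial e1 g) (partial e2 g) (partial e3 g)
     (partial e1 (partial e1 g)) (partial e2 (partial e1 g)) (partial e3 (partial e1 g))
     (partial e1 (partial e2 g)) (partial e2 (partial e2 g)) (partial e3 (partial e2 g))
     (partial e1 (partial e3 g)) (partial e2 (partial e3 g)) (partial e3 (partial e3 g))
     (fun p => smooth3_has_partial _ (SP _ B1) e1 p B1) (fun p => smooth3_has_partial _ (SP _ B1) e2 p B2)
     (fun p => smooth3_has_partial _ (SP _ B1) e3 p B3) (fun p => smooth3_has_partial _ (SP _ B2) e1 p B1)
     (fun p => smooth3_has_partial _ (SP _ B2) e2 p B2) (fun p => smooth3_has_partial _ (SP _ B2) e3 p B3)
     (fun p => smooth3_has_partial _ (SP _ B3) e1 p B1) (fun p => smooth3_has_partial _ (SP _ B3) e2 p B2)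
     (fun p => smooth3_has_partial _ (SP _ B3) e3 p B3)
     (smooth3_cont _ (SP _ B1)) (smooth3_cont _ (SP _ B2)) (smooth3_cont _ (SP _ B3))
     (smooth3_cont _ (SPP _ _ B1 B1)) (smooth3_cont _ (SPP _ _ B2 B1)) (smooth3_cont _ (SPP _ _ B3 B1))
     (smooth3_cont _ (SPP _ _ B1 B2)) (smooth3_cont _ (SPP _ _ B2 B2)) (smooth3_cont _ (SPP _ _ B3 B2))
     (smooth3_cont _ (SPP _ _ B1 B3)) (smooth3_cont _ (SPP _ _ B2 B3)) (smooth3_cont _ (SPP _ _ B3 B3))
     p).
Qed.
End Waves.

(** * The Cauchy problem for the wave equation *)

Lemma partial_partial_eq {E : NormedModule R_AbsRing} (v v' : E) (g gv : E -> R) (p : E) (l : R) :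
  (forall q, has_partial v g q (gv q)) -> has_partial v' gv p l ->
  partial v' (partial v g) p = l.
Proof.
  intros H1 H2. apply partial_eq. apply has_partial_locally with gv; auto.
  apply filter_forall. intros q. symmetry. now apply partial_eq.
Qed.

Lemma has_partial_plus {E : NormedModule R_AbsRing} (v : E) (g k : E -> R) p l m :
  has_partial v g p l -> has_partial v k p m -> has_partial v (fun q => g q + k q) p (l + m).
Proof. apply (is_derive_plus (slice g p v) (slice k p v) 0). Qed.

Lemma velocity_wave_plus g k p : smooth3 g -> smooth3 k ->
  velocity_wave (fun x => g x + k x) p = velocity_wave g p + velocity_wave k p.
Proof.
  intros Hg Hk. unfold velocity_wave.
  rewrite weighted_mean_plus by auto using cont_one3, smooth3_cont. ring.
Qed.

Lemma position_wave_plus g k p : smooth3 g -> smooth3 k ->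
  position_wave (fun x => g x + k x) p = position_wave g p + position_wave k p.
Proof.
  intros Hg Hk. unfold position_wave.
  rewrite weighted_mean_plus, radial_mean_plus by auto using cont_one3, smooth3_cont. ring.
Qed.

Definition kirchhoff (w0 w1 : R3 -> R) (p : R31) : R := position_wave w0 p + velocity_wave w1 p.

Section Kirchhoff.
Variables (w0 w1 : R3 -> R).
Hypotheses (S0 : smooth3 w0) (S1 : smooth3 w1).

Lemma smooth31_kirchhoff : smooth31 (kirchhoff w0 w1).
Proof.
  intros n. apply class_C_plus; [now apply smooth31_position_wave|now apply smooth31_velocity_wave].
Qed.

Lemma kirchhoff_dx v p : In v basis3 ->
  has_partial (v, 0) (kirchhoff w0 w1) p (kirchhoff (partial v w0) (partial v w1) p).
Proof.
  intros Hv. apply has_partial_plus; [now apply position_wave_dx|now apply velocity_wave_dx].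
Qed.

(** At t = 0 this gives the initial velocity; used twice it gives the wave
    equation. *)
Lemma kirchhoff_dt p : has_partial dt (kirchhoff w0 w1) p (kirchhoff w1 (lap w0) p).
Proof.
  unfold kirchhoff at 2. rewrite Rplus_comm.
  apply has_partial_plus; [now apply position_wave_dt|now apply velocity_wave_dt].
Qed.
End Kirchhoff.

Lemma kirchhoff_wave_equation w0 w1 p : smooth3 w0 -> smooth3 w1 ->
  partial dt (partial dt (kirchhoff w0 w1)) p = laplacian (kirchhoff w0 w1) p.
Proof.
  intros S0 S1. destruct in_basis3 as [B1 [B2 B3]].
  rewrite (partial_partial_eq dt dt _ (kirchhoff w1 (lap w0)) p (kirchhoff (lap w0) (lap w1) p));
    try intros; try apply kirchhoff_dt; auto using smooth3_lap.
  assert (HS : forall v, In v basis3 -> partial ((v, 0) : R31) (partial ((v, 0) : R31) (kirchhoff w0 w1)) p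
    = kirchhoff (partial v (partial v w0)) (partial v (partial v w1)) p).
  { intros v Hv. apply partial_partial_eq with (kirchhoff (partial v w0) (partial v w1));
    intros; apply kirchhoff_dx; auto using smooth3_partial. }
  unfold laplacian, dx1, dx2, dx3. rewrite !HS by assumption.
  unfold kirchhoff, lap.
  rewrite !position_wave_plus, !velocity_wave_plus; auto using smooth3_plus, smooth3_partial.
  ring.
Qed.

Lemma weighted_mean_0 (g : R3 -> R) (x : R3) : weighted_mean one3 g (x, 0) = g x.
Proof.
  rewrite <- (sphere_mean_const (g x)). apply sphere_mean_ext. intros [[a b] c].
  destruct x as [[x y] z]. unfold one3, ray; simpl. rewrite Rmult_1_l. f_equal.
  apply triple_eq; ring.
Qed.

Lemma kirchhoff_0 w0 w1 x : kirchhoff w0 w1 (x, 0) = w0 x.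
Proof.
  unfold kirchhoff, position_wave, velocity_wave, time; simpl. rewrite weighted_mean_0. ring.
Qed.

Lemma cauchy_schwarz_sphere a b c x y z : a ^ 2 + b ^ 2 + c ^ 2 = 1 ->
  Rabs (a * x + b * y + c * z) <= sqrt (x ^ 2 + y ^ 2 + z ^ 2).
Proof.
  intros H. rewrite <- (sqrt_Rsqr_abs (a * x + b * y + c * z)). apply sqrt_le_1_alt.
  unfold Rsqr.
  pose proof (pow2_ge_0 (a * y - b * x)). pose proof (pow2_ge_0 (a * z - c * x)).
  pose proof (pow2_ge_0 (b * z - c * y)).
  replace (x ^ 2 + y ^ 2 + z ^ 2) with ((a ^ 2 + b ^ 2 + c ^ 2) * (x ^ 2 + y ^ 2 + z ^ 2))
    by (rewrite H; ring).
  nra.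
Qed.

Lemma weighted_mean_sum (w0 q1 q2 q3 w1 : R3 -> R) (p : R31) :
  cont w0 -> cont q1 -> cont q2 -> cont q3 -> cont w1 ->
  has_mean (fun om => w0 (ray p om) + time p * (fst (fst om) * q1 (ray p om)
      + snd (fst om) * q2 (ray p om) + snd om * q3 (ray p om) + w1 (ray p om)))
    (weighted_mean one3 w0 p + time p * (weighted_mean (fun om => one3 om * fst (fst om)) q1 p
      + (weighted_mean (fun om => one3 om * snd (fst om)) q2 p
        + weighted_mean (fun om => one3 om * snd om) q3 p)) + time p * weighted_mean one3 w1 p).
Proof.
  intros c0 c1 c2 c3 c4. pose proof cont_one3 as cone.
  assert (cr : cont (ray p)) by (unfold ray; cont_tac).
  split; [cont_tac|].
  eapply has_mean_unique.
  - split; [|reflexivity]. cont_tac.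
  - repeat lazymatch goal with
        | |- has_mean _ (_ + _) => eapply has_mean_plus
        | |- has_mean _ (_ * _) => eapply has_mean_scal
        | |- has_mean _ (weighted_mean _ _ _) => eapply has_mean_weighted
        end; cont_tac.
  - intros om. unfold one3. cbv beta. ring.
Qed.

(** All terms are gathered under one average over the sphere; the factor of t
    is then bounded pointwise, using that the direction is a unit vector. *)
Lemma kirchhoff_bounds w0 w1 m M d p : smooth3 w0 -> smooth3 w1 ->
  (forall x, m <= w0 x <= M) -> (forall x, norm (grad w0 x) + Rabs (w1 x) <= d) ->
  m - Rabs (snd p) * d <= kirchhoff w0 w1 p <= M + Rabs (snd p) * d.
Proof.
  intros S0 S1 Hw Hd. destruct in_basis3 as [B1 [B2 B3]].
  pose proof (smooth3_cont _ S0) as c0. pose proof (smooth3_cont _ S1) as c1.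
  pose proof (smooth3_cont _ (smooth3_partial _ S0 _ B1)) as d1.
  pose proof (smooth3_cont _ (smooth3_partial _ S0 _ B2)) as d2.
  pose proof (smooth3_cont _ (smooth3_partial _ S0 _ B3)) as d3.
  assert (Hder : forall x a b c, a ^ 2 + b ^ 2 + c ^ 2 = 1 ->
    Rabs (time p * (a * partial e1 w0 x + b * partial e2 w0 x + c * partial e3 w0 x + w1 x))
      <= Rabs (snd p) * d).
  { intros x a b c H. rewrite Rabs_mult. apply Rmult_le_compat_l; [apply Rabs_pos|].
    eapply Rle_trans; [apply Rabs_triang|]. eapply Rle_trans; [|apply (Hd x)].
    apply Rplus_le_compat_r. unfold grad. rewrite norm_R3.
    now apply cauchy_schwarz_sphere. }
  pose proof (weighted_mean_sum w0 (partial e1 w0) (partial e2 w0) (partial e3 w0) w1 p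
    c0 d1 d2 d3 c1) as [K1 K2].
  change (kirchhoff w0 w1 p) with (weighted_mean one3 w0 p + time p * radial_mean one3 w0 p
    + time p * weighted_mean one3 w1 p).
  unfold radial_mean. rewrite <- K2.
  split; match goal with |- ?l <= ?r => 
    match l with sphere_mean _ => rewrite <- (sphere_mean_const r) 
    | _ => rewrite <- (sphere_mean_const l) end end;
    apply sphere_mean_le; auto using (@cont_const);
    intros a b c H; cbn [fst snd]; specialize (Hder (ray p (a, b, c)) a b c H);
    apply Rabs_le_between in Hder; specialize (Hw (ray p (a, b, c))); lra.
Qed.

(** * Inverting a strictly increasing function *)

Definition strictly_increasing (phi : R -> R) : Prop := forall x y, x < y -> phi x < phi y.

Lemma strictly_increasing_reflects phi x y : strictly_increasing phi -> phi x < phi y -> x < y.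
Proof.
  intros H Hxy. apply Rnot_le_lt. intros [Hl|Heq].
  - apply H in Hl. lra.
  - subst. lra.
Qed.

Lemma strictly_increasing_reflects_le phi x y : strictly_increasing phi -> phi x <= phi y -> x <= y.
Proof.
  intros H Hxy. apply Rnot_lt_le. intros Hl. apply H in Hl. lra.
Qed.

Lemma strictly_increasing_le phi x y : strictly_increasing phi -> x <= y -> phi x <= phi y.
Proof. intros H [Hl|Heq]; [apply Rlt_le; auto|subst; lra]. Qed.

(** Only the values on the range of [phi] matter. *)
Definition left_inverse (phi : R -> R) (w : R) : R := real (Lub_Rbar (fun y => phi y <= w)).

Lemma left_inverse_correct phi y : strictly_increasing phi -> left_inverse phi (phi y) = y.
Proof.
  intros H. unfold left_inverse.
  rewrite (is_lub_Rbar_unique _ (Finite y)); auto.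
  split.
  - intros z Hz. simpl. now apply (strictly_increasing_reflects_le phi).
  - intros b Hb. apply (Hb y). lra.
Qed.

(** Monotonicity alone: u stays within eps of u(p) as long as w stays strictly
    between phi(u(p) - eps) and phi(u(p) + eps). *)
Lemma continuous_implicit {U : UniformSpace} (phi : R -> R) (u w : U -> R) (p : U) :
  strictly_increasing phi -> locally p (fun q => phi (u q) = w q) ->
  continuous w p -> continuous u p.
Proof.
  intros Hphi Hloc Hw. apply filterlim_locally. intros eps.
  pose proof (locally_singleton _ _ Hloc) as Hp. pose proof (cond_pos eps) as He.
  assert (H1 : phi (u p - eps) < w p) by (rewrite <- Hp; apply Hphi; lra).
  assert (H2 : w p < phi (u p + eps)) by (rewrite <- Hp; apply Hphi; lra).
  assert (Hopen : locally (w p) (fun z => phi (u p - eps) < z < phi (u p + eps))).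
  { apply filter_and; [apply (open_gt (phi (u p - eps)) (w p) H1)
                      |apply (open_lt (phi (u p + eps)) (w p) H2)]. }
  generalize (filter_and _ _ Hloc (Hw _ Hopen)). apply filter_imp.
  intros q [Hq [Q1 Q2]]. rewrite <- Hq in Q1, Q2.
  apply strictly_increasing_reflects in Q1; auto. apply strictly_increasing_reflects in Q2; auto.
  apply Rabs_def1; unfold minus, plus, opp; simpl; lra.
Qed.

Lemma filterlim_difference_quotient (g : R -> R) (x l : R) :
  is_derive g x l <->
  filterlim (fun h => (g (x + h) - g x) / h) (locally' 0) (locally l).
Proof.
  split.
  - intros H. apply is_derive_Reals in H. apply filterlim_locally. intros eps.
    destruct (H eps (cond_pos eps)) as [d Hd]. exists d.
    intros h Hh Hh0. apply Hd; auto.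
    change (Rabs (h - 0) < d) in Hh. now rewrite Rminus_0_r in Hh.
  - intros H. apply is_derive_Reals. intros eps Heps.
    destruct (proj1 (filterlim_locally _ _) H (mkposreal eps Heps)) as [d Hd]. exists d.
    intros h Hh0 Hh. apply (Hd h); auto.
    change (Rabs (h - 0) < d). now rewrite Rminus_0_r.
Qed.

(** Carathéodory's argument: phi(y) - phi(y0) = (y - y0) q(y) with q
    continuous at y0 and q(y0) = d, so that the difference quotient of v is
    that of om divided by q(v). *)
Lemma is_derive_implicit (phi v om : R -> R) (d l : R) :
  is_derive phi (v 0) d -> d <> 0 -> continuous v 0 ->
  locally 0 (fun h => phi (v h) = om h) -> is_derive om 0 l -> is_derive v 0 (l / d).
Proof.
  intros Hphi Hd Hv Hloc Hom.
  pose proof (locally_singleton _ _ Hloc) as H0.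
  set (q := fun y => if Req_EM_T y (v 0) then d else (phi y - phi (v 0)) / (y - v 0)).
  assert (Hq : continuous q (v 0)).
  { apply filterlim_locally. intros eps.
    apply is_derive_Reals in Hphi. destruct (Hphi eps (cond_pos eps)) as [e He].
    exists e. intros y Hy. change (Rabs (y - v 0) < e) in Hy.
    unfold q at 1. destruct (Req_EM_T (v 0) (v 0)) as [_|n]; [|now contradict n].
    unfold q. destruct (Req_EM_T y (v 0)) as [_|n]; [apply ball_center|].
    specialize (He (y - v 0)). replace (v 0 + (y - v 0)) with y in He
      by (symmetry; apply Rplus_minus).
    apply He; auto. intros E; apply n; lra. }
  assert (Hqv : filterlim (fun h => q (v h)) (locally' 0) (locally d)).
  { replace d with (q (v 0)).
    2:{ unfold q. destruct (Req_EM_T (v 0) (v 0)) as [_|n]; [easy|now contradict n]. }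
    assert (Hc : filterlim (fun h => q (v h)) (locally 0) (locally (q (v 0)))).
    { apply (continuous_comp v q); auto. }
    intros P HP. exact (filter_le_within (F := locally 0) (fun h => h <> 0) _ (Hc P HP)). }
  apply filterlim_difference_quotient in Hom. apply filterlim_difference_quotient.
  assert (Hlim : filterlim (fun h => (om (0 + h) - om 0) / h * / q (v h)) (locally' 0) (locally (l * / d))).
  { apply (filterlim_comp_2 (G := locally l) (H := locally (/ d))
      (fun h => (om (0 + h) - om 0) / h) (fun h => / q (v h)) Rmult); auto.
    - apply (filterlim_comp _ _ _ (fun h => q (v h)) Rinv _ (locally d)); auto.
      apply (continuous_Rinv d Hd).
    - apply (filterlim_mult l (/ d)). }
  revert Hlim. apply filterlim_ext_loc.
  assert (Hne : locally' 0 (fun h => q (v h) <> 0)).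
  { apply (Hqv (fun y => y <> 0)). now apply open_neq. }
  assert (Hloc' : locally' 0 (fun h => phi (v h) = om h)) 
    by exact (filter_le_within (F := locally 0) (fun h => h <> 0) _ Hloc).
  assert (Hh : locally' 0 (fun h => h <> 0)).
  { exists (mkposreal 1 Rlt_0_1). auto. }
  generalize (filter_and _ _ Hh (filter_and _ _ Hne Hloc')). apply filter_imp.
  intros h [Hh0 [Hqh Hom']]. rewrite !Rplus_0_l, <- Hom', <- H0.
  assert (E : phi (v h) - phi (v 0) = (v h - v 0) * q (v h)).
  { unfold q. destruct (Req_EM_T (v h) (v 0)) as [e|n]; [rewrite e; ring|field; lra]. }
  rewrite E. field. auto.
Qed.

(** * The transformation F *)

Section Transformation.
Variable f : R -> R.
Hypothesis f_smooth : forall n, class_C1 n f.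

(** Equal to 1 / F'(y). *)
Definition recip_dF (y : R) : R := exp (RInt f 0 y).

Lemma continuous_R_of_class_C1 (g : R -> R) : class_C1 0 g -> cont g.
Proof. intros [H _] x. now apply H. Qed.

Lemma is_derive_RInt_0 (g : R -> R) (x : R) : cont g -> is_derive (RInt g 0) x (g x).
Proof.
  intros Hg. apply (is_derive_RInt g (RInt g 0) 0 x); auto.
  apply filter_forall. intros y. apply (RInt_correct g 0 y), ex_RInt_cont, Hg.
Qed.

Lemma cont_f : cont f.
Proof. apply continuous_R_of_class_C1, f_smooth. Qed.

Lemma is_derive_recip_dF y : is_derive recip_dF y (f y * recip_dF y).
Proof.
  apply (is_derive_comp exp (RInt f 0) y (recip_dF y) (f y)).
  - apply is_derive_exp.
  - apply is_derive_RInt_0, cont_f.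
Qed.

Lemma is_derive_dF y : is_derive (fun s => exp (- RInt f 0 s)) y (- f y * exp (- RInt f 0 y)).
Proof.
  apply (is_derive_comp exp (fun s => - RInt f 0 s) y (exp (- RInt f 0 y)) (- f y)).
  - apply is_derive_exp.
  - apply (is_derive_opp (RInt f 0) y (f y)). apply is_derive_RInt_0, cont_f.
Qed.

(** Each derivative of a solution of g' = c g is again a product of smooth
    functions with g, so the equation bootstraps. *)
Lemma class_C1_linear_ode (c g : R -> R) : (forall n, class_C1 n c) ->
  (forall y, is_derive g y (c y * g y)) -> forall n, class_C1 n g.
Proof.
  intros Hc Hg n. induction n as [|n IH].
  - split; auto. intros x _. apply (ex_derive_continuous g x). exists (c x * g x). apply Hg.
  - apply (class_C1_S n g (fun y => c y * g y)); auto. apply class_C_mult; auto. apply Hc.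
Qed.

Lemma class_C1_recip_dF n : class_C1 n recip_dF.
Proof. apply class_C1_linear_ode with f; auto using is_derive_recip_dF. Qed.

Lemma class_C1_dF n : class_C1 n (fun s => exp (- RInt f 0 s)).
Proof.
  apply class_C1_linear_ode with (fun y => -1 * f y).
  - intros m. apply class_C_mult; [apply class_C_const|apply f_smooth].
  - intros y. replace (-1 * f y) with (- f y) by ring. apply is_derive_dF.
Qed.

Lemma is_derive_F y : is_derive (F f) y (exp (- RInt f 0 y)).
Proof.
  apply (is_derive_RInt_0 (fun s => exp (- RInt f 0 s))).
  apply continuous_R_of_class_C1, class_C1_dF.
Qed.

Lemma class_C1_F n : class_C1 n (F f).
Proof.
  destruct n as [|n]; [apply class_C_weaken|]; apply (class_C1_S _ _ _ is_derive_F), class_C1_dF.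
Qed.

Lemma dF_recip_dF y : exp (- RInt f 0 y) * recip_dF y = 1.
Proof. unfold recip_dF. rewrite <- exp_plus, Rplus_opp_l. apply exp_0. Qed.

Lemma strictly_increasing_F : strictly_increasing (F f).
Proof.
  intros x y Hxy.
  destruct (MVT_gen (F f) x y (fun y => exp (- RInt f 0 y))) as [c [_ Hc]].
  - intros; apply is_derive_F.
  - intros z _. apply continuity_pt_filterlim. apply (ex_derive_continuous (F f) z).
    eexists; apply is_derive_F.
  - pose proof (exp_pos (- RInt f 0 c)). nra.
Qed.

Lemma F_reaches y1 y2 w : F f y1 <= w <= F f y2 -> exists y, y1 <= y <= y2 /\ F f y = w.
Proof.
  intros Hw.
  assert (H12 : y1 <= y2) by (apply (strictly_increasing_reflects_le (F f)); [apply strictly_increasing_F|lra]).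
  destruct (IVT_gen (F f) y1 y2 w) as [y [Hy1 Hy2]].
  - intros z. apply continuity_pt_filterlim. apply (ex_derive_continuous (F f) z).
    eexists; apply is_derive_F.
  - rewrite Rmin_left, Rmax_right; lra.
  - rewrite Rmin_left, Rmax_right in Hy1 by lra. now exists y.
Qed.

Section Solution.
Variables (T : Rbar) (w : R31 -> R).
Hypothesis w_smooth : smooth31 w.
Hypothesis w_range : forall t : R, Rbar_lt t T -> exists y1 y2, forall p : R31,
  Rabs (snd p) <= t -> F f y1 <= w p <= F f y2.

Let u (p : R31) : R := left_inverse (F f) (w p).

Lemma solution_bounds (t : R) : Rbar_lt t T -> exists y1 y2, forall p : R31,
  Rabs (snd p) <= t -> y1 <= u p <= y2 /\ F f (u p) = w p.
Proof.
  intros Ht. destruct (w_range t Ht) as [y1 [y2 H]]. exists y1, y2. intros p Hp.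
  destruct (F_reaches y1 y2 (w p) (H p Hp)) as [y [Hy Hw]].
  unfold u. rewrite <- Hw, left_inverse_correct; auto using strictly_increasing_F.
Qed.

Lemma F_solution (p : R31) : slab T p -> F f (u p) = w p.
Proof.
  intros Hp. destruct (solution_bounds (Rabs (snd p)) Hp) as [y1 [y2 H]]. apply H. lra.
Qed.

Lemma open_slab : open (slab T).
Proof.
  assert (H : open (fun t : R => Rbar_lt (Rabs t) T)).
  { apply (open_comp Rabs (fun t => Rbar_lt t T)).
    - intros x _. apply continuous_Rabs.
    - destruct T as [r| |]; simpl; [apply open_lt|apply open_true|apply open_false]. }
  intros p Hp.
  exact (cont_snd (V := prod_UniformSpace (prod_UniformSpace R_UniformSpace R_UniformSpace)
    R_UniformSpace) (W := R_UniformSpace) p _ (H (snd p) Hp)).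
Qed.

Lemma continuous_solution (p : R31) : slab T p -> continuous u p.
Proof.
  intros Hp. apply (continuous_implicit (F f) u w).
  - apply strictly_increasing_F.
  - generalize (open_slab p Hp). apply filter_imp. apply F_solution.
  - now apply (class_C_continuous 0 basis31 everywhere w).
Qed.

Lemma has_partial_w v p : In v basis31 -> has_partial v w p (partial v w p).
Proof. intros Hv. now apply (class_C_has_partial 0 basis31 everywhere). Qed.

(** Differentiating F(u) = w gives F'(u) d_v u = d_v w. *)
Lemma has_partial_solution v p : In v basis31 -> slab T p ->
  has_partial v u p (partial v w p * recip_dF (u p)).
Proof.
  intros Hv Hp.
  assert (Hloc : locally (0 : R) (fun h => slab T (plus p (scal h v)))).
  { apply (continuous_slice_arg p v 0). rewrite scal_R0, plus_zero_r. now apply open_slab. }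
  replace (partial v w p * recip_dF (u p)) with (partial v w p / exp (- RInt f 0 (slice u p v 0))).
  - apply (is_derive_implicit (F f) (slice u p v) (slice w p v)).
    + apply is_derive_F.
    + pose proof (exp_pos (- RInt f 0 (slice u p v 0))). lra.
    + exact (continuous_slice u p v (continuous_solution p Hp)).
    + revert Hloc. apply filter_imp. intros h. apply F_solution.
    + now apply has_partial_w.
  - rewrite slice_0. unfold recip_dF, Rdiv. now rewrite exp_Ropp, Rinv_inv.
Qed.

(** The formula for the first derivatives expresses them through u itself, so
    one more derivative is gained at each step. *)
Lemma class_C_solution n : class_C n basis31 (slab T) u.
Proof.
  induction n as [|n IH]; split; auto using continuous_solution.
  intros v Hv. exists (fun p => partial v w p * recip_dF (u p)). split.
  - intros p Hp. now apply has_partial_solution.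
  - apply class_C_mult.
    + apply class_C_subset with everywhere; [easy|].
      apply class_C_partial; auto. apply open_everywhere.
    + apply class_C_comp; auto using class_C1_recip_dF.
Qed.

Lemma partial_solution v p : In v basis31 -> slab T p ->
  partial v u p = partial v w p * recip_dF (u p).
Proof. intros Hv Hp. now apply partial_eq, has_partial_solution. Qed.

(** The term in [f] comes from differentiating 1 / F'(u); summed over the
    directions with signs it is the nonlinearity. *)
Lemma partial_partial_solution v p : In v basis31 -> slab T p ->
  partial v (partial v u) p
  = partial v (partial v w) p * recip_dF (u p) + f (u p) * partial v u p ^ 2.
Proof.
  intros Hv Hp. apply partial_eq.
  apply has_partial_locally with (fun q => partial v w q * recip_dF (u q)).
  { generalize (open_slab p Hp). apply filter_imp. intros q Hq. symmetry. now apply partial_solution. }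
  pose proof (is_derive_mult (slice (partial v w) p v) (slice (fun q => recip_dF (u q)) p v) 0
    (partial v (partial v w) p) (partial v w p * recip_dF (u p) * (f (u p) * recip_dF (u p)))) as HM.
  rewrite !slice_0 in HM.
  eapply has_partial_value; [apply HM|].
  - apply (class_C_has_partial 0 basis31 everywhere); auto; [|exact I].
    apply class_C_partial; auto using open_everywhere.
  - apply has_partial_comp; [apply is_derive_recip_dF|now apply has_partial_solution].
  - apply Rmult_comm.
  - rewrite partial_solution by assumption. unfold plus, mult; simpl. ring.
Qed.

Lemma in_basis31 : In dx1 basis31 /\ In dx2 basis31 /\ In dx3 basis31 /\ In dt basis31.
Proof. unfold basis31; simpl; auto 8. Qed.

Lemma solution_equation p : slab T p ->
  partial dt (partial dt w) p = laplacian w p ->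
  partial dt (partial dt u) p - laplacian u p
    = f (u p) * (partial dt u p ^ 2 - norm (grad_x u p) ^ 2).
Proof.
  intros Hp Hwave. destruct in_basis31 as [B1 [B2 [B3 B4]]].
  unfold grad_x. rewrite norm_R3, pow2_sqrt.
  2: { repeat apply Rplus_le_le_0_compat; apply pow2_ge_0. }
  unfold laplacian. rewrite !partial_partial_solution by assumption.
  rewrite Hwave. unfold laplacian. ring.
Qed.

Lemma bounded_solution (t : R) : Rbar_lt t T -> bounded_on (closed_slab t) u.
Proof.
  intros Ht. destruct (solution_bounds t Ht) as [y1 [y2 H]].
  exists (Rmax (Rabs y1) (Rabs y2)). intros p Hp.
  destruct (H p) as [Hu _]; [now apply Rabs_le|].
  change (Rabs (u p) <= Rmax (Rabs y1) (Rabs y2)).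
  apply Rabs_le.
  pose proof (Rmax_l (Rabs y1) (Rabs y2)). pose proof (Rmax_r (Rabs y1) (Rabs y2)).
  pose proof (Rle_abs y2). pose proof (Rle_abs (- y1)). rewrite Rabs_Ropp in *. lra.
Qed.

Lemma solvable_of_wave (u0 u1 : R3 -> R) : Rbar_lt 0 T ->
  (forall p, partial dt (partial dt w) p = laplacian w p) ->
  (forall x, w (x, 0) = F f (u0 x)) ->
  (forall x, partial dt w (x, 0) = exp (- RInt f 0 (u0 x)) * u1 x) ->
  solvable_up_to f u0 u1 T.
Proof.
  intros HT Hwave Hw0 Hw1. destruct in_basis31 as [B1 [B2 [B3 B4]]].
  assert (Hu0 : forall x, u (x, 0) = u0 x).
  { intros x. unfold u. rewrite Hw0. apply left_inverse_correct, strictly_increasing_F. }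
  exists u. split; [|apply bounded_solution].
  split; [|split; [|split]].
  - apply class_C_smooth_on; [apply open_slab|apply class_C_solution].
  - intros p Hp. now apply solution_equation.
  - exact Hu0.
  - intros x. rewrite partial_solution; auto.
    + rewrite Hw1, Hu0. rewrite Rmult_assoc, (Rmult_comm (u1 x)), <- Rmult_assoc, dF_recip_dF. ring.
    + unfold slab; simpl. now rewrite Rabs_R0.
Qed.
End Solution.
End Transformation.

(** * Suprema and infima of the data *)

Lemma sup_fun_ge {X : Type} (g : X -> R) (M : R) (x : X) :
  (forall x, g x <= M) -> g x <= sup_fun g.
Proof.
  intros HM. unfold sup_fun.
  destruct (Lub_Rbar_correct (fun y => exists x : X, y = g x)) as [H1 H2].
  pose proof (H1 (g x) (ex_intro _ x eq_refl)) as H3.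
  assert (H4 : Rbar_le (Lub_Rbar (fun y => exists x : X, y = g x)) M).
  { apply H2. intros y [z ->]. apply HM. }
  destruct (Lub_Rbar _); simpl in *; easy.
Qed.

Lemma inf_fun_le {X : Type} (g : X -> R) (M : R) (x : X) :
  (forall x, M <= g x) -> inf_fun g <= g x.
Proof.
  intros HM. unfold inf_fun.
  destruct (Glb_Rbar_correct (fun y => exists x : X, y = g x)) as [H1 H2].
  pose proof (H1 (g x) (ex_intro _ x eq_refl)) as H3.
  assert (H4 : Rbar_le M (Glb_Rbar (fun y => exists x : X, y = g x))).
  { apply H2. intros y [z ->]. apply HM. }
  destruct (Glb_Rbar _); simpl in *; easy.
Qed.

Lemma Linfty_norm_ge {X : Type} {V : NormedModule R_AbsRing} (g : X -> V) (x : X) :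
  bounded_on everywhere g -> norm (g x) <= Linfty_norm g.
Proof.
  intros [M HM]. apply (sup_fun_ge (fun x => norm (g x)) M). intros y. now apply HM.
Qed.

Lemma below_at_m_infty (phi : R -> R) (L : Rbar) (c : R) :
  is_lim phi m_infty L -> Rbar_lt L c -> exists y, phi y < c.
Proof.
  intros Hlim Hc.
  destruct (Hlim (fun z => z < c)) as [K HK].
  - destruct L as [a| |]; simpl in *.
    + now apply (open_lt c a).
    + easy.
    + exists c. auto.
  - exists (K - 1). apply HK. lra.
Qed.

Lemma above_at_p_infty (phi : R -> R) (L : Rbar) (c : R) :
  is_lim phi p_infty L -> Rbar_lt c L -> exists y, c < phi y.
Proof.
  intros Hlim Hc.
  destruct (Hlim (fun z => c < z)) as [K HK].
  - destruct L as [a| |]; simpl in *.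
    + now apply (open_gt c a).
    + exists c. auto.
    + easy.
  - exists (K + 1). apply HK. lra.
Qed.

(** The limit is not attained, by strict monotonicity; this makes the lifespan
    positive. *)
Lemma above_lim_m_infty (phi : R -> R) (a y : R) : strictly_increasing phi ->
  is_lim phi m_infty a -> a < phi y.
Proof.
  intros Hphi Hlim. apply Rnot_le_lt. intros Hle.
  assert (H1 : phi (y - 1) < a) by (apply Rlt_le_trans with (phi y); auto; apply Hphi; lra).
  destruct (Hlim (fun z => phi (y - 1) < z)) as [K HK].
  - now apply (open_gt (phi (y - 1)) a).
  - pose proof (Rmin_l (y - 1) K). pose proof (Rmin_r (y - 1) K).
    specialize (HK (Rmin (y - 1) K - 1) ltac:(lra)).
    apply strictly_increasing_reflects in HK; auto. lra.
Qed.

Lemma below_lim_p_infty (phi : R -> R) (b y : R) : strictly_increasing phi ->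
  is_lim phi p_infty b -> phi y < b.
Proof.
  intros Hphi Hlim. apply Rnot_le_lt. intros Hle.
  assert (H1 : b < phi (y + 1)) by (apply Rle_lt_trans with (phi y); auto; apply Hphi; lra).
  destruct (Hlim (fun z => z < phi (y + 1))) as [K HK].
  - now apply (open_lt (phi (y + 1)) b).
  - pose proof (Rmax_l (y + 1) K). pose proof (Rmax_r (y + 1) K).
    specialize (HK (Rmax (y + 1) K + 1) ltac:(lra)).
    apply strictly_increasing_reflects in HK; auto. lra.
Qed.

(** * The lifespan *)

Section Data.
Variables (f : R -> R) (u0 u1 : R3 -> R).
Hypotheses (f_smooth : forall n, class_C1 n f) (u0_smooth : smooth3 u0) (u1_smooth : smooth3 u1)
  (u0_bounded : bounded_on everywhere u0) (grad_u0_bounded : bounded_on everywhere (grad u0))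
  (u1_bounded : bounded_on everywhere u1).

Let E (x : R3) : R := exp (- RInt f 0 (u0 x)).
Let w0 (x : R3) : R := F f (u0 x).
Let w1 (x : R3) : R := E x * u1 x.

Lemma smooth3_w0 : smooth3 w0.
Proof. intros n. apply class_C_comp; auto using class_C1_F. Qed.

Lemma smooth3_w1 : smooth3 w1.
Proof.
  intros n. apply class_C_mult; auto.
  apply (class_C_comp n basis3 everywhere (fun y => exp (- RInt f 0 y)) u0); auto using class_C1_dF.
Qed.

Lemma u0_bounds : exists M, forall x, - M <= u0 x <= M.
Proof.
  destruct u0_bounded as [M HM]. exists M. intros x. apply Rabs_le_between. now apply HM.
Qed.

Lemma u0_between x : inf_fun u0 <= u0 x <= sup_fun u0.
Proof.
  destruct u0_bounds as [M HM]. split.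
  - apply inf_fun_le with (- M). apply HM.
  - apply sup_fun_ge with M. apply HM.
Qed.

Lemma derive_F_le_sup x : E x <= sup_fun (fun x => Derive (F f) (u0 x)).
Proof.
  destruct u0_bounds as [M HM].
  assert (Hd : forall y, Derive (F f) y = exp (- RInt f 0 y)).
  { intros y. now apply is_derive_unique, is_derive_F. }
  unfold E. rewrite <- Hd.
  destruct (continuity_ab_maj (fun y => exp (- RInt f 0 y)) (- M) M) as [m [Hm _]].
  - specialize (HM x). lra.
  - intros c _. apply continuity_pt_filterlim.
    apply (continuous_R_of_class_C1 (fun y => exp (- RInt f 0 y))). now apply class_C1_dF.
  - apply (sup_fun_ge (fun x => Derive (F f) (u0 x)) (exp (- RInt f 0 m))).
    intros z. rewrite Hd. now apply Hm.
Qed.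

Let d : R := (Linfty_norm (grad u0) + Linfty_norm u1) * sup_fun (fun x => Derive (F f) (u0 x)).

(** Both data of the linear problem carry the same factor F'(u0), which is
    bounded by its supremum along u0. *)
Lemma speed_bound x : norm (grad w0 x) + Rabs (w1 x) <= d.
Proof.
  destruct in_basis3 as [B1 [B2 B3]].
  assert (HE : 0 < E x) by apply exp_pos.
  assert (Hp : forall v, In v basis3 -> partial v w0 x = E x * partial v u0 x).
  { intros v Hv. rewrite Rmult_comm. apply partial_eq.
    apply (has_partial_comp v u0 (F f)); [now apply is_derive_F|now apply smooth3_has_partial]. }
  assert (Hg : norm (grad w0 x) = E x * norm (grad u0 x)).
  { unfold grad. rewrite !norm_R3, !Hp by assumption.
    rewrite <- (sqrt_pow2 (E x)) at 4 by lra.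
    rewrite <- sqrt_mult_alt by apply pow2_ge_0. f_equal. ring. }
  rewrite Hg. unfold w1. rewrite Rabs_mult, (Rabs_pos_eq (E x)) by lra.
  rewrite <- Rmult_plus_distr_l. unfold d. rewrite Rmult_comm.
  pose proof (Linfty_norm_ge (grad u0) x grad_u0_bounded) as H1.
  pose proof (Linfty_norm_ge u1 x u1_bounded) as H2.
  change (norm (u1 x)) with (Rabs (u1 x)) in H2.
  pose proof (norm_ge_0 (grad u0 x)). pose proof (Rabs_pos (u1 x)).
  apply Rmult_le_compat; try lra. apply derive_F_le_sup.
Qed.

Lemma d_ge_0 : 0 <= d.
Proof.
  eapply Rle_trans; [|apply (speed_bound (0, 0, 0))].
  apply Rplus_le_le_0_compat; [apply norm_ge_0|apply Rabs_pos].
Qed.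

Lemma solvable_within (N : R) : 0 < N ->
  (forall r, 0 <= r < N -> exists y1 y2,
     F f y1 <= F f (inf_fun u0) - r /\ F f (sup_fun u0) + r <= F f y2) ->
  solvable_up_to f u0 u1 (lifespan f u0 u1 N).
Proof.
  intros HN Hr. pose proof d_ge_0 as Hd.
  assert (HT : forall t : R, Rbar_lt t (lifespan f u0 u1 N) -> t * d < N).
  { intros t. unfold lifespan, quot. fold d. destruct (Req_EM_T d 0) as [e|n].
    - intros _. rewrite e. lra.
    - simpl. intros Ht. apply Rmult_lt_compat_r with (r := d) in Ht; [|lra].
      now replace (N / d * d) with N in Ht by (field; lra). }
  apply (solvable_of_wave f f_smooth _ (kirchhoff w0 w1)).
  - apply smooth31_kirchhoff; [apply smooth3_w0|apply smooth3_w1].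
  - intros t Ht. apply HT in Ht.
    destruct (Rlt_le_dec t 0) as [Hneg|Hpos].
    { exists 0, 0. intros p Hp. pose proof (Rabs_pos (snd p)). lra. }
    destruct (Hr (t * d)) as [y1 [y2 [H1 H2]]].
    { split; auto. now apply Rmult_le_pos. }
    exists y1, y2. intros p Hp.
    pose proof (kirchhoff_bounds w0 w1 (F f (inf_fun u0)) (F f (sup_fun u0)) d p smooth3_w0 smooth3_w1) as HK.
    destruct HK as [HK1 HK2].
    + intros x. destruct (u0_between x). split; apply strictly_increasing_le; auto;
      now apply strictly_increasing_F.
    + apply speed_bound.
    + assert (Rabs (snd p) * d <= t * d) by now apply Rmult_le_compat_r.
      lra.
  - unfold lifespan, quot. fold d. destruct (Req_EM_T d 0) as [e|n]; simpl; auto.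
    apply Rdiv_lt_0_compat; lra.
  - intros p. apply kirchhoff_wave_equation; [apply smooth3_w0|apply smooth3_w1].
  - intros x. apply kirchhoff_0.
  - intros x. rewrite (partial_eq _ _ _ _ (kirchhoff_dt w0 w1 smooth3_w0 smooth3_w1 (x, 0))).
    apply kirchhoff_0.
Qed.

Lemma reaches_down (L : Rbar) (c : R) :
  is_lim (F f) m_infty L -> Rbar_lt L c -> exists y, F f y <= c.
Proof. intros H Hc. destruct (below_at_m_infty _ _ _ H Hc) as [y Hy]. exists y. lra. Qed.

Lemma reaches_up (L : Rbar) (c : R) :
  is_lim (F f) p_infty L -> Rbar_lt c L -> exists y, c <= F f y.
Proof. intros H Hc. destruct (above_at_p_infty _ _ _ H Hc) as [y Hy]. exists y. lra. Qed.
End Data.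

Theorem proposition1p10 (f : R -> R) (u0 u1 : R3 -> R)
    (f_smooth : forall (n : nat) (x : R), ex_derive_n f n x)
    (u0_smooth : smooth_on basis3 everywhere u0)
    (u1_smooth : smooth_on basis3 everywhere u1)
    (u0_bounded : bounded_on everywhere u0)
    (grad_u0_bounded : bounded_on everywhere (grad u0))
    (u1_bounded : bounded_on everywhere u1) :
  (* F(-oo) = a, F(+oo) = +oo *)
  (forall a : R,
     is_lim (F f) m_infty a -> is_lim (F f) p_infty p_infty ->
     solvable_up_to f u0 u1
       (lifespan f u0 u1 (F f (inf_fun u0) - a))) /\
  (* F(-oo) = -oo, F(+oo) = b *)
  (forall b : R,
     is_lim (F f) m_infty m_infty -> is_lim (F f) p_infty b ->
     solvable_up_to f u0 u1
       (lifespan f u0 u1 (b - F f (sup_fun u0)))) /\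
  (* F(-oo) = a, F(+oo) = b *)
  (forall a b : R,
     is_lim (F f) m_infty a -> is_lim (F f) p_infty b ->
     solvable_up_to f u0 u1
       (lifespan f u0 u1
          (Rmin (F f (inf_fun u0) - a) (b - F f (sup_fun u0))))).
Proof.
  pose proof (class_C1_of_ex_derive_n f f_smooth) as Hf.
  pose proof (strictly_increasing_F f Hf) as HF.
  assert (Hmain : forall A B : Rbar, is_lim (F f) m_infty A -> is_lim (F f) p_infty B ->
    forall N, 0 < N ->
    (forall r, 0 <= r < N -> Rbar_lt A (F f (inf_fun u0) - r) /\ Rbar_lt (F f (sup_fun u0) + r) B) ->
    solvable_up_to f u0 u1 (lifespan f u0 u1 N)).
  { intros A B HA HB N HN Hr.
    apply solvable_within; auto; try (intros n; now apply smooth_on_class_C).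
    intros r Hrr. destruct (Hr r Hrr) as [H1 H2].
    destruct (reaches_down f A _ HA H1) as [y1 Hy1].
    destruct (reaches_up f B _ HB H2) as [y2 Hy2].
    now exists y1, y2. }
  split; [|split].
  - intros a Ha Hb. pose proof (above_lim_m_infty _ a (inf_fun u0) HF Ha).
    apply (Hmain a p_infty); auto; [lra|]. intros r Hr. simpl. split; auto; lra.
  - intros b Ha Hb. pose proof (below_lim_p_infty _ b (sup_fun u0) HF Hb).
    apply (Hmain m_infty b); auto; [lra|]. intros r Hr. simpl. split; auto; lra.
  - intros a b Ha Hb.
    pose proof (above_lim_m_infty _ a (inf_fun u0) HF Ha).
    pose proof (below_lim_p_infty _ b (sup_fun u0) HF Hb).
    apply (Hmain a b); auto; [apply Rmin_glb_lt; lra|].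
    pose proof (Rmin_l (F f (inf_fun u0) - a) (b - F f (sup_fun u0))).
    pose proof (Rmin_r (F f (inf_fun u0) - a) (b - F f (sup_fun u0))).
    intros r Hr. simpl. lra.
Qed.
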